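(* Let $K$ be a field, let $t\geq 2$ be an integer, let $G$ be a finite simple bipartite graph, and let $H$ be a spanning subgraph of $G$. For $e\in E(G)\setminus E(H)$, let $H+e$ denote the spanning subgraph of $G$ with edge set $E(H)\cup\{e\}$. Then the inclusion of simplicial complexes $\mathrm{NM}_t(H)\hookrightarrow \mathrm{NM}_t(H+e)$ induces an injection on reduced simplicial homology $$\widetilde H_{2t-3}(\mathrm{NM}_t(H);K)\hookrightarrow \widetilde H_{2t-3}(\mathrm{NM}_t(H+e);K).$$
   Context: All graphs are finite and simple; $V(G)$, $E(G)$ denote the vertex and edge sets. A spanning subgraph of $G$ is a subgraph with vertex set $V(G)$. For $W\subseteq E(G)$, $G_W$ denotes the spanning subgraph of $G$ with edge set $W$. The matching number $\nu(G)$ is the maximum number of pairwise disjoint edges in $G$. For an integer $t\ge 2$, the $t$-non-matching complex of $G$ is the simplicial complex on $E(G)$ given by $\mathrm{NM}_t(G)=\{W\subseteq E(G): \nu(G_W)<t\}$. *)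

(* Defs.v *)
From HB Require Import structures.
From mathcomp Require Import all_boot all_order all_algebra.
From mathcomp Require Import generic_quotient ring_quotient.

Set Implicit Arguments.
Unset Strict Implicit.
Unset Printing Implicit Defensive.

Import GRing.Theory.
Local Open Scope ring_scope.
Local Open Scope quotient_scope.

Section QuotientSpace.
Variables (K : fieldType) (vT : vectType K) (U : {vspace vT}).

(* [pred_of_vspace U] carries the [zmodClosed] structure, so this is the
   quotient group of [vT] by [U]; the scaling is added below. *)
Definition quotv : Type := Quotient.quot (pred_of_vspace U).

HB.instance Definition _ := GRing.Zmodule.on quotv.
HB.instance Definition _ :=
  EqQuotient.copy quotv (Quotient.quot (pred_of_vspace U)).

Definition classv (x : vT) : quotv := \pi_quotv x.

Lemma classv_eq x y : (classv x == classv y) = (x - y \in U).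
Proof. by rewrite Quotient.idealrBE. Qed.

Lemma classv_repr (q : quotv) : classv (repr q) = q.
Proof. exact: reprK. Qed.

Lemma classvD : {morph classv : x y / x + y}.
Proof. by move=> x y; rewrite /classv !piE. Qed.

Definition scaleq (a : K) (q : quotv) : quotv := classv (a *: repr q).

Lemma classvZ_subproof a x : classv (a *: x) = scaleq a (classv x).
Proof.
apply/eqP; rewrite classv_eq -scalerBr memvZ // -classv_eq classv_repr //.
Qed.

Fact scaleqA a b q : scaleq a (scaleq b q) = scaleq (a * b) q.
Proof. by rewrite -(classv_repr q) -!classvZ_subproof scalerA. Qed.

Fact scale1q : left_id 1 scaleq.
Proof. by move=> q; rewrite -(classv_repr q) -!classvZ_subproof scale1r. Qed.

Fact scaleqDr : right_distributive scaleq +%R.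
Proof.
move=> a p q; rewrite -(classv_repr p) -(classv_repr q).
by rewrite -classvD -!classvZ_subproof scalerDr classvD.
Qed.

Fact scaleqDl q : {morph scaleq^~ q : a b / a + b}.
Proof.
move=> a b; rewrite -(classv_repr q).
by rewrite -!classvZ_subproof scalerDl classvD.
Qed.

HB.instance Definition _ :=
  GRing.Zmodule_isLmodule.Build K quotv scaleqA scale1q scaleqDr scaleqDl.

Fact classv_is_linear : linear classv.
Proof. by move=> a x y; rewrite classvD classvZ_subproof. Qed.

HB.instance Definition _ := GRing.isLinear.Build K vT quotv _ classv
  classv_is_linear.

End QuotientSpace.

Record scomplex (V : finType) := SComplex {
  faces :> {set {set V}};
  faces_closed : forall s s' : {set V},
    s \in faces -> s' \subset s -> s' \in faces
}.

Section Chains.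
Variables (K : fieldType) (V : finType).

(* Chains of all complexes on [V], in all degrees: formal linear combinations
   of subsets of [V].  A subset [s] stands for the oriented simplex whose
   vertices are listed in the order [enum V]. *)
Definition chain : Type := {ffun {set V} -> K^o}.
HB.instance Definition _ := Vector.on chain.

Definition simplex (s : {set V}) : chain := [ffun s' => (s' == s)%:R].

Definition position (v : V) (s : {set V}) : nat :=
  #|[set u in s | (enum_rank u < enum_rank v)%N]|.

Definition simplex_boundary (s : {set V}) : chain :=
  \sum_(v in s) (-1) ^+ position v s *: simplex (s :\ v).

(* Singletons are sent to the empty simplex (augmentation). *)
Definition boundary (c : chain) : chain := \sum_s c s *: simplex_boundary s.

Fact boundary_is_linear : linear boundary.
Proof.
move=> a x y; rewrite /boundary scaler_sumr -big_split /=.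
by apply: eq_bigr => s _; rewrite !ffunE scalerDl scalerA.
Qed.

HB.instance Definition _ := GRing.isLinear.Build K chain chain _ boundary
  boundary_is_linear.

Lemma boundary_simplex s : boundary (simplex s) = simplex_boundary s.
Proof.
rewrite /boundary (bigD1 s) //= big1 ?addr0 => [|s' /negPf nes].
  by rewrite ffunE eqxx scale1r.
by rewrite ffunE nes scale0r.
Qed.

Lemma position_swap (s : {set V}) u v : u \in s ->
    (enum_rank u < enum_rank v)%N ->
  position v s = (position v (s :\ u)).+1 /\ position u (s :\ v) = position u s.
Proof.
move=> us uv; split.
  rewrite /position (cardsD1 u) inE us uv; congr _.+1.
  by apply: eq_card => w; rewrite !inE andbA.
apply: eq_card => w; rewrite !inE; case: eqP => //= ->.
by rewrite ltnNge ltnW // andbF.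
Qed.

Lemma boundary_boundary c : boundary (boundary c) = 0.
Proof.
rewrite {2}/boundary linear_sum big1 //= => s _; rewrite linearZ /=.
suff -> : boundary (simplex_boundary s) = 0 by rewrite scaler0.
pose F v u : chain := (-1) ^+ position v s *:
  ((-1) ^+ position u (s :\ v) *: simplex (s :\ v :\ u)).
have FN u v : u \in s -> (enum_rank u < enum_rank v)%N -> F v u = - F u v.
  move=> us uv; have [Ev Eu] := position_swap us uv.
  rewrite /F Ev Eu exprS mulN1r scaleNr !scalerA mulrC; congr (- (_ *: simplex _)).
  by apply/setP=> w; rewrite !inE andbCA.
transitivity (\sum_(v in s) \sum_(u in s | u != v) F v u).
  rewrite linear_sum; apply: eq_bigr => v _.
  rewrite linearZ /= boundary_simplex /simplex_boundary scaler_sumr.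
  by apply: eq_bigl => u; rewrite !inE andbC.
transitivity (\sum_(v in s) \sum_(u in s | (enum_rank u < enum_rank v)%N) F v u
   + \sum_(v in s) \sum_(u in s | (enum_rank v < enum_rank u)%N) F v u).
  rewrite -big_split /=; apply: eq_bigr => v _.
  rewrite (bigID (fun u => (enum_rank u < enum_rank v)%N)) /=; congr (_ + _).
    apply: eq_bigl => u; case: eqP => [->|_]; rewrite ?andbT //.
    by rewrite ltnn !andbF.
  apply: eq_bigl => u; rewrite -leqNgt leq_eqVlt -andbA; congr (_ && _).
  case: eqP => [->|nuv] /=; first by rewrite ltnn.
  by case: eqP => // /val_inj/enum_rank_inj/esym.
rewrite [X in _ + X](exchange_big_dep (mem s)) //=; last by move=> ? ? _ /andP[].
rewrite -big_split big1 //= => v vs.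
rewrite (eq_bigr (fun u => - F u v)); last by move=> u /andP[us uv]; exact: FN.
rewrite sumrN addrC; apply/eqP; rewrite subr_eq0; apply/eqP.
by apply: eq_bigl => u; rewrite vs.
Qed.

End Chains.

Section Homology.
Variables (K : fieldType) (V : finType) (X : scomplex V) (d : int).

(* Simplices of dimension [d] have [d + 1] vertices; [set0] has dimension -1. *)
Definition chains : {vspace chain K V} :=
  (\sum_(s in X | (#|s|%:Z == d + 1)%R) <[simplex K s]>)%VS.

Definition cycles : {vspace chain K V} :=
  (chains :&: lker (linfun (@boundary K V)))%VS.

End Homology.

Definition boundaries (K : fieldType) (V : finType) (X : scomplex V) (d : int)
  : {vspace chain K V} := (linfun (@boundary K V) @: chains K X (d + 1)%R)%VS.

Lemma boundaries_cycles (K : fieldType) (V : finType) (X : scomplex V) d :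
  (boundaries K X d <= cycles K X d)%VS.
Proof.
apply/subvP=> _ /memv_imgP[c cX ->]; rewrite memv_cap memv_ker.
rewrite !lfunE /= boundary_boundary eqxx andbT.
have /memv_sumP[f fX ->] := cX; rewrite linear_sum memv_suml // => s /andP[sX ds].
have /vlineP[a ->] := fX s (introT andP (conj sX ds)).
rewrite linearZ memvZ //= boundary_simplex memv_suml // => v vs.
rewrite memvZ // /chains (bigD1 (s :\ v)) /=.
  by rewrite (subvP (addvSl _ _)) ?memv_line.
rewrite (faces_closed sX) ?subD1set //=.
by move: ds; rewrite (cardsD1 v) vs add1n -addn1 PoszD => /eqP/addIr->.
Qed.

(* The preimage under [vsval] is [boundaries] viewed as a subspace of the
   type of cycles, cf. [boundaries_cycles]. *)
Definition reduced_homology (K : fieldType) (V : finType) (X : scomplex V)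
    (d : int) : lmodType K :=
  quotv (linfun (@vsval K _ (cycles K X d)) @^-1: boundaries K X d)%VS.

Definition homology_class (K : fieldType) (V : finType) (X : scomplex V)
    (d : int) (z : subvs_of (cycles K X d)) : reduced_homology K X d :=
  classv _ z.

Section Inclusion.
Variables (K : fieldType) (V : finType) (X Y : scomplex V) (d : int).
Hypothesis XY : X \subset Y.

Lemma chainsS n : (chains K X n <= chains K Y n)%VS.
Proof.
apply/subv_sumP => s /andP[sX ds]; rewrite /chains (bigD1 s) ?addvSl //=.
by rewrite (subsetP XY).
Qed.

Lemma cyclesS : (cycles K X d <= cycles K Y d)%VS.
Proof. exact: capvS (chainsS d) (subvv _). Qed.

Lemma boundariesS : (boundaries K X d <= boundaries K Y d)%VS.
Proof. exact: limgS (chainsS _). Qed.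

Definition cycle_incl (z : subvs_of (cycles K X d)) : subvs_of (cycles K Y d) :=
  Subvs (subvP cyclesS _ (subvsP z)).

(* Well defined on classes: see [homology_inclE]. *)
Definition homology_incl (h : reduced_homology K X d) : reduced_homology K Y d :=
  homology_class (cycle_incl (repr (h : quotv _))).

Lemma homology_inclE z :
  homology_incl (homology_class z) = homology_class (cycle_incl z).
Proof.
apply/eqP; rewrite classv_eq -memv_preim lfunE /=.
apply: (subvP boundariesS).
have : classv _ (repr (homology_class z : quotv _)) == homology_class z.
  by rewrite classv_repr.
by rewrite classv_eq -memv_preim lfunE.
Qed.

Fact homology_incl_is_linear : linear homology_incl.
Proof.
move=> a x y; rewrite -(classv_repr x) -(classv_repr y) -linearP.
rewrite !homology_inclE /homology_class -linearP; congr (classv _ _).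
exact: val_inj.
Qed.

HB.instance Definition _ := GRing.isLinear.Build K
  (reduced_homology K X d) (reduced_homology K Y d) _ homology_incl
  homology_incl_is_linear.

End Inclusion.

Arguments homology_incl K {V X Y} d XY h.

(* Finite simple graphs with vertex set [T]; edges are 2-element subsets. *)
Record sgraph (T : finType) := SGraph {
  edges : {set {set T}};
  edges_card2 : {in edges, forall e : {set T}, #|e| = 2%N}
}.

Section Graphs.
Variable T : finType.
Implicit Types (G H : sgraph T) (W : {set {set T}}).

Definition bipartite G :=
  exists A : {set T}, forall e, e \in edges G ->
    exists x y, [/\ x \in A, y \notin A & e = [set x; y]].

(* All graphs on [T] have the same vertex set. *)
Definition spanning_subgraph H G := edges H \subset edges G.

Fact edge_subgraph_subproof G W :
  {in edges G :&: W, forall e : {set T}, #|e| = 2%N}.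
Proof. by move=> e /setIP[/edges_card2]. Qed.

(* The graph G_W; only used for [W \subset edges G]. *)
Definition edge_subgraph G W : sgraph T := SGraph (@edge_subgraph_subproof G W).

Definition matching_number G : nat :=
  \max_(M : {set {set T}} | (M \subset edges G) && trivIset M) #|M|.

Definition nm_faces (t : nat) G : {set {set {set T}}} :=
  [set W : {set {set T}} | (W \subset edges G)
                         & (matching_number (edge_subgraph G W) < t)%N].

Lemma matching_numberS G H : edges H \subset edges G ->
  (matching_number H <= matching_number G)%N.
Proof.
move=> HG; apply/bigmax_leqP => M /andP[MH tM].
by apply: (@leq_bigmax_cond _ _ (fun M : {set {set T}} => #|M|));
  rewrite (subset_trans MH HG).
Qed.

Fact nm_faces_closed t G (W W' : {set {set T}}) :
  W \in nm_faces t G -> W' \subset W -> W' \in nm_faces t G.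
Proof.
rewrite !inE => /andP[WG nW] W'W; rewrite (subset_trans W'W WG) /=.
by apply: leq_ltn_trans nW; apply: matching_numberS; rewrite setIS.
Qed.

Definition NM (t : nat) G : scomplex {set T} := SComplex (@nm_faces_closed t G).

Lemma NM_sub t G H : edges H \subset edges G -> NM t H \subset NM t G.
Proof.
move=> HG; apply/subsetP => W; rewrite !inE => /andP[WH nW].
rewrite (subset_trans WH HG) /=; apply: leq_ltn_trans nW.
by apply: matching_numberS => /=; rewrite subsetI subsetIr subIset // WH orbT.
Qed.

(* H + e, as a spanning subgraph of G. *)
Definition add_edge G H (e : {set T}) : sgraph T :=
  edge_subgraph G (e |: edges H).

Lemma NM_add_edge t G H e : spanning_subgraph H G ->
  NM t H \subset NM t (add_edge G H e).
Proof. by move=> HG; apply: NM_sub; rewrite subsetI subsetUr andbT. Qed.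

End Graphs.

(* Main.v *)
(* A set of faces of a complex is called collapsible with bound [m]
   when it can be removed piece by piece, from above, each piece being a pair
   [W, v |: W] or a single (critical) face with at most [m] elements; relative
   cycles on sets of more than [m] edges are then relative boundaries.  With
   k = t - 1, it suffices that the faces of NM_t(H + e) that contain e are
   collapsible with bound 2k, since H_(2k-1) concerns chains on 2k edges, which
   are bounded by chains on 2k + 1 edges.

   By König's theorem a face W is an edge set with a vertex cover of size at
   most k.  Let x be the left end of e and W' the set of edges of W that avoid x.
   Among the minimum covers of W' take the one, (A, B), with smallest left part
   A and largest right part B.  For a fixed (A, B) the condition on W splits into
   independent ones: the edges of W' between A and B are free, those from A to
   the complement of B satisfy Hall's condition with surplus 1 on A, those from B
   to the complement of A satisfy Hall's condition on B, and the edges at x are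
   free if |A| + |B| < k and have right end in B otherwise.
   Hall families with surplus c <= 1 on n vertices are collapsible with bound
   2n - 1 + c, by induction on n: at a vertex a, and for c = 1 at an edge of W at
   a, the largest set S avoiding a that is tight for Hall's condition splits the
   family again into independent factors. *)
Require Import Defs.
From mathcomp Require Import all_boot all_order all_algebra.
From mathcomp Require Import zify.

Set Implicit Arguments.
Unset Strict Implicit.
Unset Printing Implicit Defensive.

Import GRing.Theory.

(** * Collapsible families of sets *)

Section Collapsible.
Variable E : finType.
Implicit Types (W D : {set E}) (F : {set {set E}}).

(** In [Coll_union] no member of [F1] contains a member of [F2], so [F2] lies on top and is the part
    removed first. *)
Inductive collapsible (s : nat) : {set {set E}} -> Prop :=
| Coll_empty : collapsible s set0
| Coll_cell W of #|W| <= s : collapsible s [set W]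
| Coll_pair W v of v \notin W : collapsible s [set W; v |: W]
| Coll_union F1 F2 of collapsible s F1 & collapsible s F2
    & (forall W1 W2, W1 \in F1 -> W2 \in F2 -> ~~ (W2 \subset W1)) :
    collapsible s (F1 :|: F2).

Lemma collapsible_leq s t F : s <= t -> collapsible s F -> collapsible t F.
Proof.
move=> st; elim=> [|W Ws|W v vW|F1 F2 _ c1 _ c2 F12].
- exact: Coll_empty.
- exact/Coll_cell/(leq_trans Ws).
- exact: Coll_pair.
- exact: Coll_union.
Qed.

(** No member of a piece of largest [rho] lies inside a member of another piece, so that piece can
    be removed first; induction on the number of pieces does the rest. *)
Lemma collapsible_bigcup (I : finType) (J : {set I}) (rho : I -> nat)
    (F : I -> {set {set E}}) s :
  (forall i, i \in J -> collapsible s (F i)) ->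
  (forall i j W1 W2, i \in J -> j \in J -> W1 \in F i -> W2 \in F j ->
     W1 \subset W2 -> i != j -> rho i < rho j) ->
  collapsible s (\bigcup_(i in J) F i).
Proof.
have [n] := ubnP #|J|; elim: n => // n IHn in J * => nJ cF ordF.
have [->|/set0Pn[i0 i0J]] := eqVneq J set0.
  by rewrite big_set0; exact: Coll_empty.
case: (arg_maxnP rho i0J) => i /= iJ imax; have {}iJ : i \in J by [].
rewrite (big_setD1 i) //= setUC; apply: Coll_union; last 1 first.
- move=> W1 W2 /bigcupP[j /setD1P[ji jJ] W1j] W2i; apply/negP=> W21.
  have := ordF i j _ _ iJ jJ W2i W1j W21; rewrite eq_sym ltnNge => /(_ ji).
  by move/negP; apply; exact: imax.
- apply: IHn => [|j /setD1P[_]|j k W1 W2 /setD1P[_ jJ] /setD1P[_ kJ]].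
  + by by move: nJ; rewrite (cardsD1 i) iJ.
  + exact: cF.
  + exact: ordF.
- exact: cF.
Qed.

(** Pairing each [W] that avoids [v] with [v |: W] leaves no critical face, hence any bound [s] will
    do. Ordering the pairs by [#|W|] is compatible with inclusion. *)
Lemma collapsible_toggle s v F :
  (forall W, W \in F -> v |: W \in F) -> (forall W, W \in F -> W :\ v \in F) ->
  collapsible s F.
Proof.
move=> addF delF; pose J := [set W in F | v \notin W].
have -> : F = \bigcup_(W in J) [set W; v |: W].
  apply/setP=> W; apply/idP/bigcupP => [WF | [W' /setIdP[W'F vW']]].
    exists (W :\ v); first by rewrite inE delF // !inE eqxx.
    rewrite !inE; have [vW|vW] := boolP (v \in W).
      by rewrite setD1K // eqxx orbT.
    rewrite [W in W == _](_ : W = W :\ v) ?eqxx //; apply/esym/setDidPl.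
    by rewrite disjoint_sym disjoints1.
  by rewrite !inE => /orP[]/eqP->; rewrite ?addF.
apply: (@collapsible_bigcup _ _ (fun W => #|W|)) => [W /setIdP[_ vW]|].
  exact: Coll_pair.
move=> W1 W2 W1' W2' /setIdP[_ v1] /setIdP[_ v2] h1 h2 W12 neq.
apply: proper_card; rewrite properEneq neq /=; apply/subsetP=> u u1.
have uv : u != v by apply: contraNneq v1 => <-.
have u1' : u \in W1' by move: h1; rewrite !inE => /orP[]/eqP->; rewrite ?inE ?u1 ?orbT.
have := subsetP W12 _ u1'; move: h2; rewrite !inE => /orP[]/eqP-> //.
by rewrite !inE (negPf uv).
Qed.

Lemma collapsible_powerset D : collapsible 0 (powerset D).
Proof.
have [->|/set0Pn[d dD]] := eqVneq D set0.
  by rewrite powerset0; apply: Coll_cell; rewrite cards0.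
apply: (@collapsible_toggle _ d) => W; rewrite !inE => WD.
  by rewrite subUset sub1set dD.
by rewrite (subset_trans (subD1set _ _)).
Qed.

(** For [d \in D] the only critical cell is [[set d]]: removing it leaves a family closed under
    toggling [d]. *)
Lemma collapsible_nonempty D : collapsible 1 (powerset D :\ set0).
Proof.
have [->|/set0Pn[d dD]] := eqVneq D set0.
  by rewrite powerset0 setDv; exact: Coll_empty.
rewrite -(setD1K (_ : [set d] \in powerset D :\ set0)); last first.
  by rewrite !inE sub1set dD andbT; apply/set0Pn; exists d; rewrite inE.
apply: Coll_union; first by apply: Coll_cell; rewrite cards1.
  apply: (@collapsible_toggle _ d) => W; rewrite !inE => /and3P[Wd W0 WD].
    rewrite subUset sub1set dD WD !andbT; apply/andP; split.
      apply: contraNneq Wd => Wd; move/eqP: (Wd); rewrite eqEsubset subUset => /andP[/andP[_]].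
      by rewrite subset1 (negPf W0) orbF.
    by apply/set0Pn; exists d; rewrite !inE eqxx.
  rewrite (subset_trans (subD1set _ _)) // andbT; apply/andP; split.
    by apply/eqP=> /setP/(_ d); rewrite !inE eqxx.
  by apply: contraNneq Wd => /eqP; rewrite setD_eq0 subset1 (negPf W0) orbF.
move=> W1 W2; rewrite !inE => /eqP-> /and3P[Wd W0 _].
by rewrite subset1 negb_or Wd.
Qed.

(** * Joins of families with disjoint members *)

Definition setjoin F1 F2 := [set W1 :|: W2 | W1 in F1, W2 in F2].

Lemma setjoinC F1 F2 : setjoin F1 F2 = setjoin F2 F1.
Proof.
by apply/setP=> W; apply/imset2P/imset2P=> -[W1 W2 h1 h2 ->];
  exists W2 W1; rewrite // setUC.
Qed.

Lemma setjoinUl F1 F2 F : setjoin (F1 :|: F2) F = setjoin F1 F :|: setjoin F2 F.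
Proof.
apply/setP=> W; rewrite inE; apply/imset2P/orP.
  case=> W1 W2 /setUP[h|h] h2 ->; [left|right]; apply/imset2P;
  by exists W1 W2.
by case=> /imset2P[W1 W2 h1 h2 ->]; exists W1 W2; rewrite // inE h1 ?orbT.
Qed.

Lemma setjoin_sub F1 F2 F W1 W2 :
    (forall W W', W \in F1 :|: F2 -> W' \in F -> [disjoint W & W']) ->
    (forall V1 V2, V1 \in F1 -> V2 \in F2 -> ~~ (V2 \subset V1)) ->
  W1 \in setjoin F1 F -> W2 \in setjoin F2 F -> ~~ (W2 \subset W1).
Proof.
move=> dF F12 /imset2P[U1 U1' h1 h1' ->] /imset2P[U2 U2' h2 h2' ->].
apply: contra (F12 _ _ h1 h2) => /(subset_trans (subsetUl _ _)) U21.
apply/subsetP=> u u2; have := subsetP U21 _ u2; rewrite inE => /orP[//|u1'].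
have U2F : U2 \in F1 :|: F2 by rewrite inE h2 orbT.
have /pred0P/(_ u) := dF _ _ U2F h1'.
by rewrite /= u2 u1'.
Qed.

(** Critical cells of the join are unions of a critical cell of each factor, so the bounds add
    up. *)
Lemma collapsible_join s1 s2 F1 F2 : collapsible s1 F1 -> collapsible s2 F2 ->
    (forall W1 W2, W1 \in F1 -> W2 \in F2 -> [disjoint W1 & W2]) ->
  collapsible (s1 + s2) (setjoin F1 F2).
Proof.
move=> c1 c2; elim: c1 => [|W Ws|W v vW|G1 G2 _ IH1 _ IH2 G12] dF.
- have -> : setjoin set0 F2 = set0; last exact: Coll_empty.
  by apply/setP=> W; rewrite inE; apply/imset2P=> -[? ?]; rewrite inE.
- elim: c2 dF => [|W2 W2s|W2 v vW2|G1 G2 _ IH1 _ IH2 G12] dF.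
  + have -> : setjoin [set W] set0 = set0; last exact: Coll_empty.
    by apply/setP=> U; rewrite inE; apply/imset2P=> -[? ?]; rewrite !inE.
  + rewrite /setjoin imset2_set1l imset_set1; apply: Coll_cell.
    by rewrite (leq_trans (leq_card_setU _ _)) // leq_add.
  + rewrite /setjoin imset2_set1l imsetU1 imset_set1 setUCA.
    apply: Coll_pair; rewrite !inE (negPf vW2) orbF.
    have /pred0P/(_ v) := dF W (v |: W2) (set11 _) (set22 _ _).
    by rewrite /= !inE eqxx andbT => ->.
  + rewrite setjoinC setjoinUl ![setjoin _ [set W]]setjoinC.
    apply: Coll_union; [apply: IH1|apply: IH2|] => [W1 W2 h1 h2|W1 W2 h1 h2|W1 W2].
    * by apply: dF; rewrite // inE h2.
    * by apply: dF; rewrite // inE h2 orbT.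
    rewrite ![setjoin [set W] _]setjoinC; apply: setjoin_sub => // U U' h h'.
    by rewrite disjoint_sym; apply: dF.
(* Since [v] occurs in no member of [F2], joining a pair with [F2] gives a family closed under
   toggling [v]. *)
- have vF2 U : U \in F2 -> v \notin U.
    move=> UF; have /pred0P/(_ v) := dF (v |: W) U (set22 _ _) UF.
    by rewrite /= !inE eqxx /= => ->.
  apply: (@collapsible_toggle _ v) => U /imset2P[W1 W2 h1 h2 ->]; apply/imset2P.
    exists (v |: W) W2; rewrite ?set22 //.
    by move: h1; rewrite !inE => /orP[]/eqP->; rewrite ?setUA ?setUid.
  exists W W2; rewrite ?set21 // setDUl; congr (_ :|: _).
    move: h1; rewrite !inE => /orP[]/eqP->; last by rewrite setU1K.
    by apply/setDidPl; rewrite disjoint_sym disjoints1.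
  by apply/setDidPl; rewrite disjoint_sym disjoints1; exact: vF2.
- rewrite setjoinUl; apply: Coll_union.
  + by apply: IH1 => W1 W2 h1; apply: dF; rewrite inE h1.
  + by apply: IH2 => W1 W2 h1; apply: dF; rewrite inE h1 orbT.
  + by move=> W1 W2; exact: setjoin_sub.
Qed.

(** An iterated join: membership is decided separately on each colour class of [kappa], so the
    classes are independent factors. *)
Lemma collapsible_color n (kappa : E -> nat) (s : nat -> nat)
    (F : nat -> {set {set E}}) :
    (forall i, i < n -> collapsible (s i) (F i)) ->
    (forall i W (e : E), i < n -> W \in F i -> e \in W -> kappa e = i) ->
  collapsible (\sum_(i < n) s i)
    [set W : {set E} | [forall e in W, kappa e < n] &
             [forall i : 'I_n, W :&: [set e | kappa e == i] \in F i]].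
Proof.
elim: n => [|n IHn] cF kF.
  rewrite big_ord0; apply/(@collapsible_leq 0) => //.
  have -> : [set W : {set E} | [forall e in W, kappa e < 0] &
     [forall i : 'I_0, W :&: [set e | kappa e == i] \in F i]] = powerset set0.
    rewrite powerset0; apply/setP=> W; rewrite !inE; apply/andP/eqP => [[/forall_inP W0 _]|->].
      by apply/setP=> e; rewrite inE; apply/negP=> /W0.
    by split; [apply/forall_inP=> e; rewrite inE|apply/forallP=> -[]].
  exact: collapsible_powerset.
rewrite big_ord_recr /=.
have {}IHn := IHn (fun i ltin => cF i (leqW ltin)) (fun i W e ltin => kF i W e (leqW ltin)).
set G := (G in collapsible _ G); set G' := (G in collapsible _ G) in IHn.
have -> : G = setjoin G' (F n); last first.
  apply: collapsible_join => [//||W1 W2]; first exact: cF.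
  rewrite inE => /andP[/forall_inP W1n _] W2n.
  apply/pred0P=> e /=; apply/negP=> /andP[/W1n + e2].
  by rewrite (kF n W2) ?ltnn.
apply/setP=> W; rewrite inE; apply/andP/imset2P => [[/forall_inP Wn /forallP WF]|].
  exists (W :&: [set e | kappa e < n]) (W :&: [set e | kappa e == n]).
  - rewrite inE; apply/andP; split; first by apply/forall_inP=> e; rewrite !inE => /andP[].
    apply/forallP=> i; rewrite (_ : _ :&: _ = W :&: [set e | kappa e == i]).
      exact: (WF (widen_ord (leqnSn n) i)).
    apply/setP=> e; rewrite !inE -andbA; congr (_ && _).
    by case: eqP => [->|] /=; rewrite ?andbF ?ltn_ord.
  - exact: (WF ord_max).
  - apply/setP=> e; rewrite !inE -andb_orr; case eW: (e \in W) => //=.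
    by rewrite -ltnS orbC -leq_eqVlt; exact/esym/Wn.
case=> W1 W2; rewrite inE => /andP[/forall_inP W1n /forallP W1F] W2F ->.
split.
  apply/forall_inP=> e /setUP[/W1n/leqW//|e2].
  by rewrite (kF n W2).
apply/forallP=> i; have [ltin|] := ltnP i n.
  rewrite (_ : _ :&: _ = W1 :&: [set e | kappa e == i]).
    exact: (W1F (Ordinal ltin)).
  apply/setP=> e; rewrite !inE.
  case e2: (e \in W2); rewrite ?orbF //= (kF n W2) // eq_sym (ltn_eqF ltin).
  by rewrite !andbF.
move=> lein; have {lein} -> : i = n :> nat by have := ltn_ord i; lia.
rewrite (_ : _ :&: _ = W2) //; apply/setP=> e; rewrite !inE.
case e2: (e \in W2); first by rewrite orbT (kF n W2) ?eqxx.
by rewrite orbF; apply/negP=> /andP[/W1n lt_e /eqP ke]; rewrite ke ltnn in lt_e.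
Qed.

End Collapsible.

(** * Families defined by Hall's condition *)

Section Hall.
Variables (E P Q : finType) (p : E -> P) (q : E -> Q).
Implicit Types (W D : {set E}) (F : {set E}) (A S U : {set P}) (Y : {set Q}).

Definition nbhd W U : {set Q} := q @: [set e in W | p e \in U].

(** Only nonempty [U] are tested, since for [c = 1] the empty set would always violate the
    inequality. *)
Definition hall c W A : bool :=
  [forall U : {set P}, (U \subset A) ==> (U != set0) ==> (c + #|U| <= #|nbhd W U|)].

Definition hall_family c F A : {set {set E}} :=
  [set W : {set E} | (W \subset F) && hall c W A].

Lemma hallP c W A :
  reflect (forall U, U \subset A -> U != set0 -> c + #|U| <= #|nbhd W U|)
          (hall c W A).
Proof.
apply: (iffP forallP) => h U; first by move=> UA U0; move: (h U); rewrite UA U0.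
by apply/implyP=> UA; apply/implyP; exact: h.
Qed.

Lemma nbhdP W U y : reflect (exists e, [/\ e \in W, p e \in U & q e = y]) (y \in nbhd W U).
Proof.
apply: (iffP imsetP) => [[e]|[e [eW eU <-]]]; last by exists e; rewrite ?inE ?eW.
by rewrite inE => /andP[eW eU ->]; exists e.
Qed.

Lemma mem_nbhd W U e : e \in W -> p e \in U -> q e \in nbhd W U.
Proof. by move=> eW eU; apply/nbhdP; exists e. Qed.

Lemma hall_anti c W A1 A2 : A1 \subset A2 -> hall c W A2 -> hall c W A1.
Proof. by move=> A12 /hallP h; apply/hallP=> U UA; apply: h (subset_trans UA A12). Qed.

Lemma eq_hall c W W' A : {in [pred e | p e \in A], forall e, (e \in W) = (e \in W')} ->
  hall c W A = hall c W' A.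
Proof.
move=> eqW; apply: eq_forallb => U; have [UA|//] := boolP (U \subset A).
suff eqN : [set e in W | p e \in U] = [set e in W' | p e \in U] by rewrite /nbhd eqN.
apply/setP=> e; rewrite !inE.
by have [eU|] := boolP (p e \in U); rewrite ?andbF // eqW // inE (subsetP UA).
Qed.

(** * Induction step for Hall families *)

Section Step.
Variables (c : nat) (F : {set E}) (A : {set P}) (a : P) (sigma : {set E}).
Hypotheses (c1 : c <= 1) (FA : forall e, e \in F -> p e \in A) (aA : a \in A).
Hypotheses (sigmaF : sigma \subset F) (sigma_a : forall e, e \in sigma -> p e = a).
Hypotheses (card_sigma : #|sigma| = c) (card_qsigma : #|q @: sigma| = c).

(* The index [(S, Y)] of [W] consists of the largest [S], with [a] left out, such
   that [Y := nbhd W S :|: q @: sigma] has only [#|S| + c] elements. *)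
Definition hall_pieces : {set {set P} * {set Q}} :=
  [set SY : {set P} * {set Q} | [&& SY.1 \subset A :\ a,
    #|SY.2| == #|SY.1| + c & q @: sigma \subset SY.2]].

(** Here [sigma] is empty for [c = 0] and a single prescribed edge at [a] for [c = 1]. Surplus 1
    outside [Y] expresses that [S] cannot be enlarged to a bigger tight set avoiding [a]; the edge
    at [a] that leaves [Y] provides Hall's condition for sets containing [a]. *)
Definition hall_piece (SY : {set P} * {set Q}) : {set {set E}} :=
  [set W : {set E} | [&& W \subset F, sigma \subset W,
    [forall e in W, (p e \in SY.1) ==> (q e \in SY.2)],
    [exists e in W, (p e == a) && (q e \notin SY.2)] &
    hall c W SY.1 &&
    hall 1 (W :&: [set e | q e \notin SY.2]) (A :\ a :\: SY.1)]].

Lemma hall_pieceP S Y W : reflect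
  [/\ W \subset F, sigma \subset W,
      forall e, e \in W -> p e \in S -> q e \in Y,
      exists e, [/\ e \in W, p e = a & q e \notin Y] &
      hall c W S /\ hall 1 (W :&: [set e | q e \notin Y]) (A :\ a :\: S)]
  (W \in hall_piece (S, Y)).
Proof.
rewrite inE; apply: (iffP and5P) => /= -[WF sW].
  move=> /forall_inP WY /exists_inP[e eW /andP[/eqP ea eY]] /andP[hS hA].
  split=> //; last by exists e.
  by move=> e' /WY/implyP.
move=> WY [e [eW ea eY]] [hS hA]; split=> //.
- by apply/forall_inP=> e' /WY/implyP.
- by apply/exists_inP; exists e; rewrite // ea eqxx.
- by rewrite hS.
Qed.

(** Adding [q @: sigma] extends the Hall bound to [U = set0], where [hall] says nothing. *)
Lemma nbhd_sigma_geq W U : hall c W U -> c + #|U| <= #|nbhd W U :|: q @: sigma|.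
Proof.
move=> /hallP hU; have [->|U0] := eqVneq U set0.
  by rewrite cards0 addn0 -card_qsigma subset_leq_card ?subsetUr.
by rewrite (leq_trans (hU U _ U0)) ?subset_leq_card ?subsetUl.
Qed.

Lemma hall_piece_cover W : W \in hall_family c F A -> sigma \subset W ->
  exists2 i, i \in hall_pieces & W \in hall_piece i.
Proof.
rewrite inE => /andP[WF hW] sW.
pose tight := [pred S : {set P} | (S \subset A :\ a) && (#|nbhd W S :|: q @: sigma| <= #|S| + c)].
have tight0 : tight set0.
  rewrite /= sub0set cards0 add0n -card_qsigma subset_leq_card // subUset subxx andbT.
  by apply/subsetP=> y /nbhdP[e []]; rewrite inE.
have [S /andP[SA leS] Smax] := arg_maxnP (fun S : {set P} => #|S|) tight0.
have SA' : S \subset A by apply: subset_trans SA (subD1set _ _).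
have [Y YE] : exists Y, Y = nbhd W S :|: q @: sigma by eexists.
(* The tight set [S] has maximal size; candidates exist because [set0] is tight. *)
rewrite -YE in leS.
have cardY : #|Y| = #|S| + c.
  apply/eqP; rewrite eqn_leq leS addnC YE nbhd_sigma_geq //.
  exact: hall_anti hW.
have WY e : e \in W -> p e \in S -> q e \in Y.
  by move=> eW eS; rewrite YE inE mem_nbhd.
exists (S, Y); first by rewrite inE /= SA cardY eqxx YE subsetUr.
apply/hall_pieceP; split=> //.
(* If all edges at [a] ended in [Y], the neighbourhood of [a |: S] would lie in [Y], which has one
   element too few for Hall's condition. *)
- have /hallP/(_ (a |: S)) := hW; rewrite subUset sub1set aA SA' => /(_ isT).
  have aS : a \notin S by apply/negP=> /(subsetP SA); rewrite !inE eqxx.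
  rewrite cardsU1 aS => /(_ _)/= hS.
  have {}hS : c + #|S|.+1 <= #|nbhd W (a |: S)|.
    by apply: hS; apply/set0Pn; exists a; rewrite !inE eqxx.
  have : ~~ (nbhd W (a |: S) \subset Y).
    by apply/negP=> /subset_leq_card; clear -hS cardY; lia.
  case/subsetPn=> y /nbhdP[e [eW eaS <-]] eY; exists e; split=> //.
  by move: eaS; rewrite !inE => /orP[/eqP //|eS]; rewrite WY in eY.
- split; first exact: hall_anti hW.
  (* A set [U] without surplus outside [Y] would make [S :|: U] tight, against the choice of [S]. *)
  apply/hallP=> U US U0; rewrite leqNgt; apply/negP=> ltU.
  have UA : U \subset A :\ a by apply: subset_trans US (subsetDl _ _).
  have dUS : [disjoint S & U].
    by rewrite disjoint_sym; move: US; rewrite subsetD => /andP[].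
  have cardSU : #|S :|: U| = #|S| + #|U|.
    by apply/eqP; rewrite (leq_card_setU S U).2.
  have U1 : 0 < #|U| by rewrite card_gt0.
  have /Smax : tight (S :|: U).
    rewrite /= subUset SA UA /=.
    have : nbhd W (S :|: U) :|: q @: sigma \subset
       Y :|: nbhd (W :&: [set e | q e \notin Y]) U.
      apply/subsetP=> y; rewrite inE => /orP[/nbhdP[e [eW eSU <-]]|ys].
        have [eY|eY] := boolP (q e \in Y); first by rewrite inE eY.
        move: eSU; rewrite inE => /orP[/(WY _ eW)|eU]; first by rewrite (negPf eY).
        by apply/setUP; right; apply: mem_nbhd; rewrite // inE eW inE.
      by rewrite YE !inE ys orbT.
    move/subset_leq_card/leq_trans; apply.
    apply: leq_trans (leq_card_setU _ _) _; rewrite cardY cardSU; clear -ltU; lia.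
  rewrite /geq /= cardSU; clear -U1; lia.
Qed.

(** The neighbours of [U] are counted inside and outside [Y]: [U :&: S] and [sigma] account for the
    former, the rest of [U] for the latter. *)
Lemma hall_piece_sub S Y W : (S, Y) \in hall_pieces -> W \in hall_piece (S, Y) ->
  W \in hall_family c F A.
Proof.
rewrite inE /= => /and3P[SA /eqP cardY qsY] /hall_pieceP[WF sW WY [e [eW ea eY]] [hS hA]].
rewrite inE WF; apply/hallP=> U UA U0.
pose U1 := U :&: S; pose U2 := (U :\: S) :\ a.
have aS : a \notin S by apply/negP=> /(subsetP SA); rewrite !inE eqxx.
have cardU : #|U| = #|U1| + #|U2| + (a \in U).
  rewrite -(cardsID S U) (cardsD1 a (U :\: S)) inE aS /= -/U1 -/U2 addnA addnAC //.
have out : #|U2| + ((a \in U) || (U2 != set0)) <= #|nbhd W U :\: Y|.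
  have sub2 : nbhd (W :&: [set e | q e \notin Y]) U2 \subset nbhd W U :\: Y.
    apply/subsetP=> y /nbhdP[g [+ gU <-]]; rewrite !inE => /andP[gW ->].
    by apply: mem_nbhd => //; move: gU; rewrite !inE => /and3P[].
  have [U20|U20] := eqVneq U2 set0.
    rewrite U20 cards0 orbF; case aU: (a \in U) => //=; apply/card_gt0P; exists (q e).
    by rewrite inE eY mem_nbhd // ea.
  rewrite orbT addn1 -add1n (leq_trans _ (subset_leq_card sub2)) //.
  have /hallP -> // := hA; apply/subsetP=> u; rewrite !inE => /and3P[-> -> uU].
  by rewrite (subsetP UA).
have inn : #|U1| + (if (a \in U) || (U1 != set0) then c else 0) <= #|nbhd W U :&: Y|.
  have sub1 : nbhd W U1 \subset nbhd W U :&: Y.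
    apply/subsetP=> y /nbhdP[g [gW]]; rewrite inE => /andP[gU gS] <-.
    by rewrite inE WY // mem_nbhd.
  have hU1 : hall c W U1 by apply: hall_anti hS; exact: subsetIr.
  case aU: (a \in U) => /=.
    rewrite addnC (leq_trans (nbhd_sigma_geq hU1)) // subset_leq_card //.
    rewrite subUset sub1 subsetI qsY andbT; apply/subsetP=> _ /imsetP[g gs ->].
    by apply: mem_nbhd; rewrite ?(subsetP sW) // (sigma_a gs).
  have [->|U10] := eqVneq U1 set0; first by rewrite cards0.
  by rewrite addnC (leq_trans _ (subset_leq_card sub1)) // (hallP _ _ _ hU1).
(* When [U] avoids both [a] and [S], the surplus 1 outside [Y] has to supply [c]; this is where
   [c <= 1] enters. *)
have : 0 < #|U| by rewrite card_gt0.
rewrite -(cardsID Y (nbhd W U)) -!card_gt0 in inn out *; rewrite cardU.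
clear -c1 inn out.
move: inn out; case: (a \in U) => /=; case: #|U1| => [|u1]; case: #|U2| => [|u2] /=; lia.
Qed.

(** Enlarging [W] shrinks its tight set. A nonempty [S2 :\: S1] would have surplus outside [Y1]
    already in [W1], so [Y2] would have more than [#|S2| + c] elements. If [S1 = S2], then [Y1] is
    the neighbourhood together with [q @: sigma], hence lies in [Y2] and equals it by size. *)
Lemma hall_piece_order i j W1 W2 : i \in hall_pieces -> j \in hall_pieces ->
  W1 \in hall_piece i -> W2 \in hall_piece j -> W1 \subset W2 -> i != j ->
  #|~: i.1| < #|~: j.1|.
Proof.
case: i j => [S1 Y1] [S2 Y2]; rewrite !inE /=.
move=> /and3P[SA1 /eqP cY1 qY1] /and3P[SA2 /eqP cY2 qY2].
move=> W1p W2p; have {}W1p : W1 \in hall_piece (S1, Y1) by rewrite inE.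
have {}W2p : W2 \in hall_piece (S2, Y2) by rewrite inE.
case/hall_pieceP: W1p => WF1 sW1 WY1 _ [hS1 hA1].
case/hall_pieceP: W2p => WF2 sW2 WY2 _ [hS2 hA2] W12 neq.
have subY2 S : S \subset S2 -> nbhd W1 S :|: q @: sigma \subset Y2.
  move=> SS; rewrite subUset qY2 andbT; apply/subsetP=> _ /nbhdP[e [eW eS <-]].
  by rewrite WY2 ?(subsetP W12) ?(subsetP SS).
have S21 : S2 \subset S1.
  rewrite -setD_eq0; apply/negPn/negP=> U0; set U := _ :\: _ in U0.
  have hU : 1 + #|U| <= #|nbhd (W1 :&: [set e | q e \notin Y1]) U|.
    by have /hallP -> // := hA1; rewrite setSD.
  have hI : c + #|S2 :&: S1| <= #|nbhd W1 (S2 :&: S1) :|: q @: sigma|.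
    apply: nbhd_sigma_geq; apply: hall_anti hS1; exact: subsetIr.
  have dis : [disjoint nbhd W1 (S2 :&: S1) :|: q @: sigma
                & nbhd (W1 :&: [set e | q e \notin Y1]) U].
    apply/pred0P=> y /=; apply/negP=> /andP[y1 /nbhdP[e [+ _ ey]]].
    rewrite !inE ey => /andP[_ /negP[]].
    move: y1; rewrite inE => /orP[/nbhdP[g [gW + <-]]|/(subsetP qY1)//].
    by rewrite inE => /andP[_]; exact: WY1.
  have sub : (nbhd W1 (S2 :&: S1) :|: q @: sigma) :|:
      nbhd (W1 :&: [set e | q e \notin Y1]) U \subset Y2.
    rewrite subUset subY2 ?subsetIl //=; apply/subsetP=> _ /nbhdP[e [+ eU <-]].
    rewrite inE => /andP[eW _]; apply: WY2; first exact: (subsetP W12).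
    by move: eU; rewrite inE => /andP[].
  move/subset_leq_card: sub; rewrite -(leq_card_setU _ _).2 in dis; rewrite (eqP dis).
  have := cardsID S1 S2; rewrite -/U; clear -hU hI cY2; lia.
rewrite ltn_neqAle subset_leq_card ?setCS // andbT.
apply: contra neq => /eqP cS.
have S12 : S1 = S2.
  apply/esym/eqP; rewrite eqEcard S21; have := cardsC S1; have := cardsC S2; clear -cS; lia.
have Y1E : nbhd W1 S1 :|: q @: sigma = Y1.
  apply/eqP; rewrite eqEcard subUset qY1 andbT cY1 addnC nbhd_sigma_geq // andbT.
  by apply/subsetP=> _ /nbhdP[e [eW eS <-]]; exact: WY1.
rewrite xpair_eqE S12 eqxx /= eqEcard cY1 cY2 S12 leqnn andbT -Y1E.
by apply: subY2; rewrite S12.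
Qed.

Lemma hall_piece_coll S Y : (S, Y) \in hall_pieces ->
    (forall c' F' A', c' <= 1 -> #|A'| < #|A| -> (forall e, e \in F' -> p e \in A') ->
      collapsible (#|A'|.*2 - (1 - c')) (hall_family c' F' A')) ->
  collapsible (#|A|.*2 - (1 - c)) (hall_piece (S, Y)).
Proof.
rewrite inE /= => /and3P[SA /eqP cardY qsY] IH.
have aS : a \notin S by apply/negP=> /(subsetP SA); rewrite !inE eqxx.
have sigmaS e : e \in sigma -> (p e \in S) = false.
  by move=> es; rewrite (sigma_a es) (negPf aS).
(* The colours 0 to 4 are the independent factors; 5 marks the edges that no
   member of the piece contains. *)
pose kappa e := if e \notin F then 5 else if e \in sigma then 0 else
  if p e \in S then (if q e \in Y then 1 else 5) else
  if q e \in Y then 2 else if p e == a then 3 else 4.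
pose D i := [set e | kappa e == i].
pose G i := match i with
  | 0 => [set sigma] | 1 => hall_family c (D 1) S | 2 => powerset (D 2)
  | 3 => powerset (D 3) :\ set0 | 4 => hall_family 1 (D 4) (A :\ a :\: S)
  | _ => [set set0] end.
pose s i := match i with 0 => c | 1 => #|S|.*2 | 2 => 0 | 3 => 1
  | 4 => #|A :\ a :\: S|.*2 | _ => 0 end.
have cardA : #|A| = (#|S| + #|A :\ a :\: S|).+1.
  rewrite (cardsD1 a A) aA add1n; congr _.+1.
  by rewrite -(cardsID S (A :\ a)) (setIidPr SA).
have kappaE e : e \in F -> kappa e = if e \in sigma then 0 else
    if p e \in S then (if q e \in Y then 1 else 5) else
    if q e \in Y then 2 else if p e == a then 3 else 4.
  by rewrite /kappa => ->.
have := @collapsible_color _ 6 kappa s G.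
(* With [a] removed, [A] splits into [S] and its complement, so [c + 2|S| + 1 + 2|A - a - S|] equals
   [2|A| - 1 + c]. *)
have -> : \sum_(i < 6) s i = #|A|.*2 - (1 - c).
  by rewrite !big_ord_recr big_ord0 /= cardA; move: c1; lia.
have GD i W e : i < 6 -> W \in G i -> e \in W -> kappa e = i.
  have sub W' : W' \subset D i -> e \in W' -> kappa e = i.
    by move=> /subsetP WD /WD; rewrite inE => /eqP.
  case: i sub => [|[|[|[|[|[|//]]]]]] sub _ /=; rewrite inE.
  - move=> /eqP -> es; rewrite kappaE ?es //; exact: (subsetP sigmaF).
  - by move=> /andP[/sub].
  - by move=> /sub.
  - by rewrite !inE => /andP[_ /sub].
  - by move=> /andP[/sub].
  - by move=> /eqP ->; rewrite inE.
have Gc i : i < 6 -> collapsible (s i) (G i).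
  case: i => [|[|[|[|[|[|//]]]]]] _ /=.
  - by apply: Coll_cell; rewrite card_sigma.
  - apply: collapsible_leq (IH _ _ _ c1 _ _); [by lia|by rewrite cardA; lia|].
    move=> e; rewrite inE /kappa; case: (e \in F) => //=; case: (e \in sigma) => //=.
    by case: (p e \in S) => //; case: (q e \in Y) => //; case: (p e == a).
  - exact: collapsible_powerset.
  - exact: collapsible_nonempty.
  - apply: collapsible_leq (IH 1 _ _ _ _ _); [by lia|by []|by rewrite cardA; lia|].
    move=> e; rewrite inE /kappa; case: ifP => // /negbFE eF.
    case: ifP => // _; case: ifP => [_|eS]; first by case: ifP.
    case: ifP => // _; case: ifP => // ea _.
    by rewrite !inE eS ea FA.
  - by apply: Coll_cell; rewrite cards0.
move=> /(_ Gc GD); congr collapsible.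
apply/setP=> W; rewrite [LHS]inE; apply/andP/hall_pieceP.
  case=> _ /forallP WG.
  have WGi i (lti : i < 6) := WG (Ordinal lti).
  have := WGi 0 isT; rewrite /= inE => /eqP W0.
  have := WGi 1 isT; rewrite /= inE => /andP[_ W1].
  have := WGi 3 isT; rewrite /= inE => /andP[W3 _].
  have := WGi 4 isT; rewrite /= inE => /andP[_ W4].
  have := WGi 5 isT; rewrite /= inE => /eqP W5.
  have notW5 e : e \in W -> kappa e <> 5.
    by move=> eW ke; have /setP/(_ e) := W5; rewrite !inE eW ke.
  have WF : W \subset F.
    by apply/subsetP=> e /notW5; rewrite /kappa; case: (e \in F).
  have WY e : e \in W -> p e \in S -> q e \in Y.
    move=> eW eS; move: (notW5 e eW); rewrite kappaE ?(subsetP WF) // eS.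
    by case es: (e \in sigma); [rewrite sigmaS in eS|case: (q e \in Y)].
  split=> //.
  - by rewrite -W0 subsetIl.
  - move: W3; rewrite inE => /set0Pn[e]; rewrite !inE => /andP[eW /eqP ke].
    exists e; move: ke; rewrite kappaE ?(subsetP WF) //.
    case: (e \in sigma) => //; case: (p e \in S); first by case: (q e \in Y).
    by case: (q e \in Y) => //; case: eqP.
  - split.
      rewrite -(eq_hall c (W := W :&: [set e | kappa e == 1])) // => e; rewrite inE => eS.
      rewrite !inE; case eW: (e \in W) => //=.
      rewrite kappaE ?(subsetP WF) // eS WY //.
      by case: ifP => // es; rewrite sigmaS in eS.
    rewrite -(eq_hall 1 (W := W :&: [set e | kappa e == 4])) // => e.
    rewrite !inE => /and3P[eS ea eA].
    case eW: (e \in W) => //=; rewrite kappaE ?(subsetP WF) //.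
    case: ifP => [/sigma_a/eqP|_]; first by rewrite (negPf ea).
    by rewrite (negPf eS) (negPf ea); case: (q e \in Y).
case=> WF sW WY [e0 [e0W e0a e0Y]] [hS hA]; split.
  apply/forall_inP=> e _; rewrite /kappa.
  by do 2 case: ifP => // _; case: ifP => _; do ![case: ifP => // _].
apply/forallP=> -[[|[|[|[|[|[|//]]]]]] lti] /=; rewrite inE.
- rewrite eqEsubset; apply/andP; split; apply/subsetP=> e.
    rewrite !inE => /andP[eW]; rewrite kappaE ?(subsetP WF) //.
    by case: ifP => // _; do ![case: ifP => // _].
  by move=> es; rewrite !inE (subsetP sW) // kappaE ?es // (subsetP sigmaF).
- rewrite subsetIr; rewrite (eq_hall c (W' := W)) // => e; rewrite inE => eS.
  rewrite !inE; case eW: (e \in W) => //=.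
  rewrite kappaE ?(subsetP WF) // eS WY //.
  by case: ifP => // es; rewrite sigmaS in eS.
- exact: subsetIr.
- rewrite powersetE subsetIr andbT !inE; apply/set0Pn; exists e0.
  rewrite !inE e0W kappaE ?(subsetP WF) //.
  rewrite e0a (negPf aS) (negPf e0Y) eqxx.
  case: ifP => // es; case/negP: e0Y; apply: (subsetP qsY); exact: imset_f.
- rewrite subsetIr; rewrite (eq_hall 1 (W' := W :&: [set e | q e \notin Y])) // => e.
  rewrite !inE => /and3P[eS ea eA].
  case eW: (e \in W) => //=; rewrite kappaE ?(subsetP WF) //.
  case: ifP => [/sigma_a/eqP|_]; first by rewrite (negPf ea).
  by rewrite (negPf eS) (negPf ea); case: (q e \in Y).
- apply/eqP/setP=> e; rewrite !inE; apply/negP=> /andP[eW].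
  rewrite kappaE ?(subsetP WF) //; case: ifP => // _.
  case: ifP => [/(WY _ eW) -> //|_].
  by do ![case: ifP => // _].
Qed.

Lemma collapsible_hall_step :
    (forall c' F' A', c' <= 1 -> #|A'| < #|A| -> (forall e, e \in F' -> p e \in A') ->
      collapsible (#|A'|.*2 - (1 - c')) (hall_family c' F' A')) ->
  collapsible (#|A|.*2 - (1 - c)) [set W in hall_family c F A | sigma \subset W].
Proof.
move=> IH.
have -> : [set W in hall_family c F A | sigma \subset W] = \bigcup_(i in hall_pieces) hall_piece i.
  apply/setP=> W; rewrite inE; apply/andP/bigcupP => [[]|[[S Y] ip Wi]].
    exact: hall_piece_cover.
  by split; [exact: hall_piece_sub Wi|case/hall_pieceP: Wi].
apply: collapsible_bigcup hall_piece_order => -[S Y] ip; exact: hall_piece_coll.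
Qed.

End Step.

(** Outer induction on [#|A|]. For [c = 0] the step applies with [sigma] empty. For [c = 1] an inner
    induction on [#|F|] separates the sets that contain a chosen edge [e] at [a], where [sigma] is
    [[set e]], from those that avoid it. *)
Lemma collapsible_hall c F A : c <= 1 -> (forall e, e \in F -> p e \in A) ->
  collapsible (#|A|.*2 - (1 - c)) (hall_family c F A).
Proof.
have [n] := ubnP #|A|; elim: n => // n IHn in c F A * => ltAn c1 FA.
have IH c' F' A' : c' <= 1 -> #|A'| < #|A| -> (forall e, e \in F' -> p e \in A') ->
    collapsible (#|A'|.*2 - (1 - c')) (hall_family c' F' A').
  by move=> c'1 ltA'; apply: IHn => //; apply: leq_trans ltA' _.
(* For empty [A] Hall's condition is vacuous, and truncated subtraction makes the bound 0, which a
   powerset satisfies. *)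
have [A0|/set0Pn[a aA]] := eqVneq A set0.
  have -> : hall_family c F A = powerset F.
    apply/setP=> W; rewrite !inE A0; case: (W \subset F) => //=.
    by apply/hallP=> U; rewrite subset0 => ->.
  exact/(@collapsible_leq _ 0)/collapsible_powerset.
case: c c1 => [|[|//]] c1.
  have -> : hall_family 0 F A = [set W in hall_family 0 F A | set0 \subset W].
    by apply/setP=> W; rewrite [in RHS]inE sub0set andbT.
  apply: (@collapsible_hall_step 0 F A a set0) => //; rewrite ?imset0 ?sub0set ?cards0 //.
  by move=> e; rewrite inE.
have [m] := ubnP #|F|; elim: m => // m IHm in F FA * => ltFm.
have [/exists_inP[e eF /eqP ea]|noa] := boolP [exists e in F, p e == a].
  have -> : hall_family 1 F A =
      hall_family 1 (F :\ e) A :|: [set W in hall_family 1 F A | [set e] \subset W].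
    apply/setP=> W; rewrite !inE subsetD1 sub1set.
    by case: (e \in W); rewrite ?andbT ?andbF ?orbF.
  apply: Coll_union.
  - apply: IHm => [g|]; first by rewrite inE => /andP[_]; exact: FA.
    by move: ltFm; rewrite (cardsD1 e F) eF.
  - apply: collapsible_hall_step IH; rewrite ?imset_set1 ?cards1 ?sub1set //.
      exact: aA.
    by move=> g; rewrite inE => /eqP->.
  - move=> W1 W2; rewrite !inE subsetD1 sub1set => /andP[/andP[_ eW1] _] /andP[_ eW2].
    by apply: contra eW1 => /subsetP->.
have -> : hall_family 1 F A = set0; last exact: Coll_empty.
apply/setP=> W; rewrite !inE; apply/negP=> /andP[WF /hallP/(_ [set a])].
rewrite sub1set aA cards1 => /(_ isT).
have -> : nbhd W [set a] = set0.
  apply/setP=> y; rewrite inE; apply/negP=> /nbhdP[e [eW ea _]].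
  by case/exists_inP: noa; exists e; rewrite ?(subsetP WF) //; move: ea; rewrite inE.
rewrite cards0 => h; suff : 1 + 1 <= 0 by [].
by apply: h; apply/set0Pn; exists a; rewrite inE.
Qed.

End Hall.

(** * Edge sets with small vertex covers *)

Section Covers.
Variables (E P Q : finType) (p : E -> P) (q : E -> Q).
Implicit Types (W F : {set E}) (A : {set P}) (B : {set Q}).

Definition covers W A B := [forall e in W, (p e \in A) || (q e \in B)].

Definition coverable K W :=
  [exists AB : {set P} * {set Q}, covers W AB.1 AB.2 && (#|AB.1| + #|AB.2| <= K)].

Lemma coversP W A B :
  reflect (forall e, e \in W -> p e \in A \/ q e \in B) (covers W A B).
Proof. by apply: (iffP forall_inP) => h e /h /orP. Qed.

Lemma coverableP K W :
  reflect (exists A B, covers W A B /\ #|A| + #|B| <= K) (coverable K W).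
Proof.
apply: (iffP existsP) => [[[A B] /andP[/= ? ?]]|[A [B [cW leK]]]]; first by exists A, B.
by exists (A, B); rewrite /= cW.
Qed.

Lemma covers_sub W1 W2 A B : W1 \subset W2 -> covers W2 A B -> covers W1 A B.
Proof. by move=> W12 /coversP cW; apply/coversP=> e /(subsetP W12)/cW. Qed.

(* [(A, B)] is the minimum cover with [A] smallest and [B] largest, see
   [tight_cover_le] and [exists_tight_cover]. *)
Definition tight_cover W A B :=
  [&& covers W A B, hall p q 1 (W :&: [set e | q e \notin B]) A
    & hall q p 0 (W :&: [set e | p e \notin A]) B].

(** Edges from [A :\: A'] that leave [B] must be covered by [B' :\: B], and symmetrically edges into
    [B :\: B'] that avoid [A] by [A' :\: A]. The two Hall conditions then compare sizes, and the
    surplus on [A] settles the case of equality. *)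
Lemma tight_cover_le W A B A' B' : tight_cover W A B -> covers W A' B' ->
  #|A| + #|B| <= #|A'| + #|B'|
  /\ (#|A'| + #|B'| <= #|A| + #|B| -> A \subset A' /\ B' \subset B).
Proof.
case/and3P=> _ /hallP hA /hallP hB /coversP cW'.
have leA : #|A :\: A'| + (A :\: A' != set0) <= #|B' :\: B|.
  have [->|n0] := eqVneq (A :\: A') set0; first by rewrite cards0.
  rewrite addnC; apply: leq_trans (hA _ (subsetDl _ _) n0) _; apply: subset_leq_card.
  apply/subsetP=> _ /nbhdP[e [+ + <-]]; rewrite !inE => /andP[eW ->] /andP[eA' _].
  by case: (cW' e eW) eA' => [->|].
have leB : #|B :\: B'| <= #|A' :\: A|.
  have [->|n0] := eqVneq (B :\: B') set0; first by rewrite cards0.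
  apply: leq_trans (hB _ (subsetDl _ _) n0) _; apply: subset_leq_card.
  apply/subsetP=> _ /nbhdP[e [+ + <-]]; rewrite !inE => /andP[eW ->] /andP[eB' _].
  by case: (cW' e eW) eB' => [|->].
rewrite -card_gt0 in leA.
have := cardsID A A'; have := cardsID A' A; have := cardsID B B'; have := cardsID B' B.
rewrite (setIC A' A) (setIC B' B) -!setD_eq0 -!cards_eq0.
by clear -leA leB; split; first lia; move=> ?; split; lia.
Qed.

(** Lexicographic order on total size and then [#|A|], packed into one number; the factor exceeds
    every possible [#|A|]. *)
Definition cover_rank (AB : {set P} * {set Q}) :=
  (#|AB.1| + #|AB.2|) * #|P|.+1 + #|AB.1|.

Lemma cover_rank_lt A B A' B' :
  (cover_rank (A, B) < cover_rank (A', B')) =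
  (#|A| + #|B| < #|A'| + #|B'|) || (#|A| + #|B| == #|A'| + #|B'|) && (#|A| < #|A'|).
Proof.
rewrite /cover_rank /=; have := max_card (mem A); have := max_card (mem A').
move: #|A| #|A'| #|B| #|B'| #|P| => a a' b b' n an a'n.
by case: (ltngtP (a + b) (a' + b')) => h /=; nia.
Qed.

(** A cover of least rank works: exchanging a violating [U] for its neighbours would give a cover
    that is smaller, or no larger with a smaller left part. *)
Lemma exists_tight_cover W : exists A B, tight_cover W A B.
Proof.
have cov0 : covers W [set: P] set0 by apply/coversP=> e _; left; rewrite inE.
have [[A B] /= cW minAB] := @arg_minnP _ ([set: P], set0)
  (fun AB : {set P} * {set Q} => covers W AB.1 AB.2) cover_rank cov0.
have {}minAB A' B' : covers W A' B' -> cover_rank (A, B) <= cover_rank (A', B').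
  exact: (minAB (A', B')).
move/coversP: (cW) => cWP.
exists A, B; rewrite /tight_cover cW /=; apply/andP; split.
  apply/hallP=> U UA; rewrite -card_gt0 => U0; set N := nbhd _ _ _ _.
  have /minAB : covers W (A :\: U) (B :|: N).
    apply/coversP=> e eW; rewrite !inE; have [eB|eB] := boolP (q e \in B); first by right.
    case: (cWP e eW) => [eA|]; last by rewrite (negPf eB).
    have [eU|_] := boolP (p e \in U); last by left.
    by right; rewrite orFb; apply: mem_nbhd; rewrite // !inE eW.
  rewrite leqNgt cover_rank_lt.
  have [+ _] := leq_card_setU B N; have := cardsID U A; rewrite (setIidPr UA).
  by clear -U0; lia.
apply/hallP=> U UB; rewrite -card_gt0 => U0; set N := nbhd _ _ _ _.
have /minAB : covers W (A :|: N) (B :\: U).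
  apply/coversP=> e eW; rewrite !inE; have [eA|eA] := boolP (p e \in A); first by left.
  case: (cWP e eW) => [|eB]; first by rewrite (negPf eA).
  have [eU|_] := boolP (q e \in U); last by right.
  by left; rewrite orFb; apply: (@mem_nbhd _ _ _ q p); rewrite // !inE eW.
rewrite leqNgt cover_rank_lt.
have [+ _] := leq_card_setU A N; have := cardsID U B; rewrite (setIidPr UB).
by clear -U0; lia.
Qed.

(** * Coverable edge sets that contain a given edge *)

Section Link.
Variables (K : nat) (F : {set E}) (e0 : E).
Hypothesis e0F : e0 \in F.

(** Meant for edges at [p e0]: either the cover has room for the vertex [p e0], or it must catch the
    edge at its right end. *)
Definition star_free (AB : {set P} * {set Q}) e :=
  (#|AB.1| + #|AB.2| < K) || (q e \in AB.2).

Definition link_pieces : {set {set P} * {set Q}} :=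
  [set AB : {set P} * {set Q} |
    [&& p e0 \notin AB.1, #|AB.1| + #|AB.2| <= K & star_free AB e0]].

Definition link_piece (AB : {set P} * {set Q}) : {set {set E}} :=
  [set W : {set E} | [&& W \subset F, e0 \in W,
    [forall e in W, (p e == p e0) ==> star_free AB e]
    & tight_cover (W :&: [set e | p e != p e0]) AB.1 AB.2]].

Lemma link_piece_cover W : W \subset F -> e0 \in W -> coverable K W ->
  exists2 i, i \in link_pieces & W \in link_piece i.
Proof.
move=> WF e0W /coverableP[A2 [B2 [cW leK]]]; set W' := W :&: [set e | p e != p e0].
have [A [B tW]] := exists_tight_cover W'; have /and3P[/coversP cW' hA hB] := tW.
have W'W : W' \subset W by exact: subsetIl.
have [leAB subAB] := tight_cover_le tW (covers_sub W'W cW).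
have x0A : p e0 \notin A.
  (* [W'] has no edge at [p e0], so this vertex cannot have surplus. *)
  apply/negP=> xA; have /hallP/(_ [set p e0]) := hA.
  rewrite sub1set xA => /(_ isT) h.
  have : nbhd p q (W' :&: [set e | q e \notin B]) [set p e0] = set0.
    apply/setP=> y; rewrite [RHS]inE; apply/negP=> /nbhdP[e []].
    by rewrite !inE => /andP[/andP[_ /negP]].
  move=> n0; rewrite n0 cards0 cards1 in h; suff : 1 + 1 <= 0 by [].
  by apply: h; apply/set0Pn; exists (p e0); rewrite inE.
have sf e : e \in W -> p e = p e0 -> star_free (A, B) e.
  move=> eW ex; rewrite /star_free /=; have [//|geK] := ltnP.
  (* Here [(A, B)] already has [K] vertices, so [(A2, B2)] is also a minimum cover of [W'] and [B2]
     lies in [B]. Moreover [p e0] is not in [A2]: dropping it would cover [W'] with fewer than [K]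
     vertices. *)
  have [_ B2B] := subAB (leq_trans leK geK).
  case/coversP/(_ e eW): (cW) => [eA2|]; last exact: (subsetP B2B).
  have : covers W' (A2 :\ p e0) B2.
    apply/coversP=> g; rewrite !inE => /andP[gW ->] /=.
    exact: (coversP _ _ _ cW).
  case/(tight_cover_le tW) => + _; rewrite -ex (cardsD1 (p e) A2) eA2 in leK *.
  by clear -leK geK; lia.
exists (A, B); first by rewrite inE /= x0A (leq_trans leAB leK) sf.
rewrite inE WF e0W tW andbT /=; apply/forall_inP=> e eW; apply/implyP=> /eqP; exact: sf.
Qed.

Lemma link_piece_sub A B W : (A, B) \in link_pieces -> W \in link_piece (A, B) ->
  [/\ W \subset F, e0 \in W & coverable K W].
Proof.
rewrite !inE /= => /and3P[x0A leK _] /and4P[WF e0W /forall_inP sf /and3P[/coversP cW _ _]].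
split=> //; apply/coverableP; have [ltK|geK] := ltnP (#|A| + #|B|) K.
  exists (p e0 |: A), B; split; last by rewrite cardsU1 x0A; clear -ltK; lia.
  apply/coversP=> e eW; rewrite !inE; have [|ex] /= := eqVneq (p e) (p e0); first by left.
  by apply: cW; rewrite !inE eW.
exists A, B; split=> //; apply/coversP=> e eW.
have [ex|ex] := eqVneq (p e) (p e0); last by apply: cW; rewrite !inE eW.
right; have := implyP (sf e eW); rewrite ex eqxx /star_free /= => /(_ isT).
by rewrite ltnNge geK.
Qed.

(** The cover of the larger set also covers the smaller one, so minimality and the tie-breaking rule
    make the rank increase. *)
Lemma link_piece_order i j W1 W2 : i \in link_pieces -> j \in link_pieces ->
  W1 \in link_piece i -> W2 \in link_piece j -> W1 \subset W2 -> i != j ->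
  cover_rank i < cover_rank j.
Proof.
case: i j => [A1 B1] [A2 B2] _ _; rewrite !inE /=.
move=> /and4P[_ _ _ t1] /and4P[_ _ _ /and3P[c2 _ _]] W12 neq.
have {}c2 := covers_sub (setSI _ W12) c2.
have [le12 sub12] := tight_cover_le t1 c2.
rewrite cover_rank_lt; case: ltngtP le12 => //= e12 _.
have [A12 B21] := sub12 (eq_leq (esym e12)).
rewrite ltn_neqAle subset_leq_card // andbT; apply: contra neq => /eqP cA.
rewrite xpair_eqE eqEcard A12 cA leqnn eq_sym eqEcard B21 /=; clear -e12 cA; lia.
Qed.

Lemma link_piece_coll A B : (A, B) \in link_pieces ->
  collapsible K.*2 (link_piece (A, B)).
Proof.
rewrite inE /= => /and3P[x0A leK sf0].
pose kappa e := if e \notin F then 5 else if e == e0 then 0 else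
  if p e == p e0 then (if star_free (A, B) e then 1 else 5) else
  if p e \in A then (if q e \in B then 2 else 3) else if q e \in B then 4 else 5.
have kappaE e : e \in F -> kappa e = if e == e0 then 0 else
  if p e == p e0 then (if star_free (A, B) e then 1 else 5) else
  if p e \in A then (if q e \in B then 2 else 3) else if q e \in B then 4 else 5.
  by rewrite /kappa => ->.
pose D i := [set e | kappa e == i].
pose G i := match i with
  | 0 => [set [set e0]] | 1 => powerset (D 1) | 2 => powerset (D 2)
  | 3 => hall_family p q 1 (D 3) A | 4 => hall_family q p 0 (D 4) B
  | _ => [set set0] end.
pose s i := match i with 0 => 1 | 3 => #|A|.*2 | 4 => #|B|.*2 - 1 | _ => 0 end.
have GD i W e : i < 6 -> W \in G i -> e \in W -> kappa e = i.
  have sub W' : W' \subset D i -> e \in W' -> kappa e = i.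
    by move=> /subsetP WD /WD; rewrite inE => /eqP.
  case: i sub => [|[|[|[|[|[|//]]]]]] sub _ /=; rewrite inE.
  - by move=> /eqP ->; rewrite inE => /eqP->; rewrite kappaE ?eqxx.
  - by move=> /sub.
  - by move=> /sub.
  - by move=> /andP[/sub].
  - by move=> /andP[/sub].
  - by move=> /eqP ->; rewrite inE.
have Gc i : i < 6 -> collapsible (s i) (G i).
  case: i => [|[|[|[|[|[|//]]]]]] _ /=.
  - by apply: Coll_cell; rewrite cards1.
  - exact: collapsible_powerset.
  - exact: collapsible_powerset.
  - apply: collapsible_leq (@collapsible_hall _ _ _ p q 1 _ A _ _) => //.
      by rewrite subn0.
    move=> e; rewrite inE /kappa.
    case: (e \in F) => //=; case: (e == e0) => //.
    case: (p e == p e0); first by case: ifP.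
    by case: (p e \in A) => //; case: (q e \in B).
  - apply: (@collapsible_hall _ _ _ q p 0) => // e; rewrite inE /kappa.
    case: (e \in F) => //=; case: (e == e0) => //.
    case: (p e == p e0); first by case: ifP.
    by case: (p e \in A) => //; case: (q e \in B).
  - by apply: Coll_cell; rewrite cards0.
(* The edge [e0] costs 1. Either the cover has fewer than [K] vertices, or [B] contains [q e0] and
   the term [2|B| - 1] is not truncated, which pays for [e0]. *)
have sK : \sum_(i < 6) s i <= K.*2.
  rewrite !big_ord_recr big_ord0 /=; move: sf0; rewrite /star_free /=.
  case/orP=> [ltK|yB]; first by clear -ltK; lia.
  have : 0 < #|B| by apply/card_gt0P; exists (q e0).
  by clear -leK; lia.
apply: collapsible_leq sK _; have := collapsible_color Gc GD; congr collapsible.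
apply/setP=> W; rewrite [LHS]inE [RHS]inE; apply/andP/and4P.
  case=> _ /forallP WG.
  have WGi i (lti : i < 6) := WG (Ordinal lti).
  have := WGi 0 isT; rewrite /= inE => /eqP W0.
  have := WGi 3 isT; rewrite /= inE => /andP[_ W3].
  have := WGi 4 isT; rewrite /= inE => /andP[_ W4].
  have := WGi 5 isT; rewrite /= inE => /eqP W5.
  have notW5 e : e \in W -> kappa e <> 5.
    by move=> eW ke; have /setP/(_ e) := W5; rewrite !inE eW ke.
  have WF : W \subset F.
    by apply/subsetP=> e /notW5; rewrite /kappa; case: (e \in F).
  have e0W : e0 \in W by have := set11 e0; rewrite -W0 inE => /andP[].
  split=> //.
    apply/forall_inP=> e eW; apply/implyP=> ex; have := notW5 e eW.
    rewrite kappaE ?(subsetP WF) // ex; case: (eqVneq e e0) => [->//|_].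
    by case: ifP.
  apply/and3P; split.
  - apply/coversP=> e; rewrite !inE => /andP[eW /negPf ex]; have := notW5 e eW.
    rewrite kappaE ?(subsetP WF) // ex.
    case: (eqVneq e e0) => [e_e0|_]; first by rewrite e_e0 eqxx in ex.
    by case: (p e \in A); [left|case: (q e \in B); [right|]].
  - rewrite -(eq_hall q 1 (W := W :&: [set e | kappa e == 3])) // => e; rewrite !inE => eA.
    have ex : (p e == p e0) = false by apply: contraNF x0A => /eqP <-.
    case eW: (e \in W) => //=; rewrite kappaE ?(subsetP WF) // ex eA.
    case: (eqVneq e e0) => [e_e0|_]; first by rewrite e_e0 eqxx in ex.
    by case: (q e \in B).
  - rewrite -(eq_hall p 0 (W := W :&: [set e | kappa e == 4])) // => e; rewrite !inE => eB.
    case eW: (e \in W) => //=; rewrite kappaE ?(subsetP WF) // eB.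
    case: (eqVneq e e0) => [->|_]; first by rewrite eqxx.
    by case: (p e == p e0); [case: ifP|case: (p e \in A)].
case=> WF e0W /forall_inP sf /and3P[/coversP cW hA hB]; split.
  apply/forall_inP=> e _; rewrite /kappa.
  by case: (e \in F) => //=; do ![case: ifP => // _].
have ex0 e : p e \in A -> (p e == p e0) = false by move=> eA; apply: contraNF x0A => /eqP <-.
apply/forallP=> -[[|[|[|[|[|[|//]]]]]] lti] /=; rewrite inE.
- apply/eqP/setP=> e; rewrite !inE; have [->|ne] := eqVneq e e0.
    by rewrite e0W kappaE ?eqxx.
  case eW: (e \in W) => //=; rewrite kappaE ?(subsetP WF) // (negPf ne).
  by do ![case: ifP => // _].
- exact: subsetIr.
- exact: subsetIr.
- rewrite subsetIr; rewrite (eq_hall q 1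
     (W' := W :&: [set e | p e != p e0] :&: [set e | q e \notin B])) // => e; rewrite !inE => eA.
  case eW: (e \in W) => //=; rewrite kappaE ?(subsetP WF) // ex0 // eA.
  case: (eqVneq e e0) => [e_e0|_]; first by have := ex0 e eA; rewrite e_e0 eqxx.
  by case: (q e \in B).
- rewrite subsetIr; rewrite (eq_hall p 0
     (W' := W :&: [set e | p e != p e0] :&: [set e | p e \notin A])) // => e; rewrite !inE => eB.
  case eW: (e \in W) => //=; rewrite kappaE ?(subsetP WF) // eB.
  case: (eqVneq e e0) => [->|_]; first by rewrite eqxx.
  by case: (p e == p e0); [case: ifP|case: (p e \in A)].
- apply/eqP/setP=> e; rewrite !inE; apply/negP=> /andP[eW].
  rewrite kappaE ?(subsetP WF) //; case: ifP => // _.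
  case: ifP => [ex|ex]; first by have := implyP (sf e eW) ex => ->.
  have : p e \in A \/ q e \in B by apply: cW; rewrite !inE eW ex.
  by case=> ->; do ![case: ifP => // _].
Qed.

Lemma collapsible_link : collapsible K.*2
  [set W : {set E} | [&& W \subset F, e0 \in W & coverable K W]].
Proof.
have -> : [set W : {set E} | [&& W \subset F, e0 \in W & coverable K W]] =
    \bigcup_(i in link_pieces) link_piece i.
  apply/setP=> W; rewrite inE; apply/and3P/bigcupP => [[]|[[A B] ip Wi]].
    exact: link_piece_cover.
  exact: link_piece_sub Wi.
apply: collapsible_bigcup link_piece_order => -[A B] ip; exact: link_piece_coll.
Qed.

End Link.

End Covers.

(** * König's theorem *)

Section Konig.
Variables (E P Q : finType) (p : E -> P) (q : E -> Q).
Implicit Types (W M : {set E}).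

Lemma coverableC K W : coverable q p K W = coverable p q K W.
Proof.
by apply/coverableP/coverableP => -[A [B [/coversP cW leK]]]; exists B, A;
  split; rewrite 1?addnC //; apply/coversP=> e /cW; rewrite or_comm.
Qed.

(** Weak duality: matching edges with left end in [A] are counted by that end, all others by their
    right end in [B]. *)
Lemma coverable_matching K W M : coverable p q K W -> M \subset W ->
  {in M &, injective p} -> {in M &, injective q} -> #|M| <= K.
Proof.
move=> /coverableP[A [B [/coversP cW leK]]] MW injp injq; apply: leq_trans leK.
rewrite -(cardsID [set e | p e \in A] M); apply: leq_add.
  rewrite -(card_in_imset (f := p)) ?subset_leq_card //.
    by apply/subsetP=> _ /imsetP[e + ->]; rewrite !inE => /andP[].
  by move=> e1 e2 /setIP[e1M _] /setIP[e2M _]; exact: injp.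
rewrite -(card_in_imset (f := q)) ?subset_leq_card //.
  apply/subsetP=> _ /imsetP[e + ->]; rewrite !inE => /andP[eA eM].
  by case: (cW e (subsetP MW e eM)) eA => [->|].
by move=> e1 e2 /setDP[e1M _] /setDP[e2M _]; exact: injq.
Qed.

(* Lovász: if two edges [e1], [e2] of an edge-critical [W] shared a vertex [v],
   uncrossing the two smaller covers of [W - e1] and [W - e2], both of which
   avoid [v], would produce a cover of [W] that is too small. *)
Lemma critical_inj K W : ~~ coverable p q K W ->
  (forall e, e \in W -> coverable p q K (W :\ e)) -> {in W &, injective p}.
Proof.
move=> ncW crit e1 e2 e1W e2W pe; apply/eqP/negPn/negP=> ne12.
have ncov A B : covers p q W A B -> K < #|A| + #|B|.
  by move=> cW; rewrite ltnNge; apply: contra ncW => leK; apply/coverableP; exists A, B.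
have /coverableP[A1 [B1 [/coversP c1 le1]]] := crit e1 e1W.
have /coverableP[A2 [B2 [/coversP c2 le2]]] := crit e2 e2W.
have nc1 : ~ (p e1 \in A1 \/ q e1 \in B1).
  move=> c; suff /ncov : covers p q W A1 B1 by rewrite ltnNge le1.
  apply/coversP=> e eW; have [->//|ne] := eqVneq e e1.
  by apply: c1; rewrite !inE ne.
have nc2 : ~ (p e2 \in A2 \/ q e2 \in B2).
  move=> c; suff /ncov : covers p q W A2 B2 by rewrite ltnNge le2.
  apply/coversP=> e eW; have [->//|ne] := eqVneq e e2.
  by apply: c2; rewrite !inE ne.
have q2 : q e2 \in B1.
  have : e2 \in W :\ e1 by rewrite !inE eq_sym ne12.
  by case/c1 => // p2; case: nc1; rewrite pe; left.
have q1 : q e1 \in B2.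
  have : e1 \in W :\ e2 by rewrite !inE ne12.
  by case/c2 => // p1; case: nc2; rewrite -pe; left.
have /ncov meet : covers p q W (A1 :&: A2) (B1 :|: B2).
  apply/coversP=> e eW; rewrite !inE.
  have [->|n1] := eqVneq e e1; first by rewrite q1 orbT; right.
  have [->|n2] := eqVneq e e2; first by rewrite q2; right.
  have d1 : e \in W :\ e1 by rewrite !inE n1.
  have d2 : e \in W :\ e2 by rewrite !inE n2.
  case: (c1 e d1) (c2 e d2) => [->|->]; last by right.
  by case=> ->; [left|rewrite orbT; right].
have /ncov join : covers p q W (p e1 |: (A1 :|: A2)) (B1 :&: B2).
  apply/coversP=> e eW; rewrite !inE.
  have [->|n1] := eqVneq e e1; first by rewrite eqxx; left.
  have [->|n2] := eqVneq e e2; first by rewrite pe eqxx; left.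
  have d1 : e \in W :\ e1 by rewrite !inE n1.
  have d2 : e \in W :\ e2 by rewrite !inE n2.
  case: (c1 e d1) (c2 e d2) => [->|->]; first by rewrite orbT; left.
  by case=> ->; [rewrite !orbT; left|right].
have := cardsUI A1 A2; have := cardsUI B1 B2.
have : #|p e1 |: (A1 :|: A2)| <= (#|A1 :|: A2|).+1 by rewrite cardsU1; case: (_ \notin _).
by clear -le1 le2 meet join; lia.
Qed.

End Konig.

(** Deleting edges while no cover of size [K] exists leads to an edge-critical set, which is itself
    the matching. *)
Lemma konig (E P Q : finType) (p : E -> P) (q : E -> Q) K (W : {set E}) :
  ~~ coverable p q K W ->
  exists M : {set E}, [/\ M \subset W, K < #|M|, {in M &, injective p}
    & {in M &, injective q}].
Proof.
have [n] := ubnP #|W|; elim: n => // n IHn in W * => ltWn ncW.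
have [/exists_inP[e eW ncWe]|crit] := boolP [exists e in W, ~~ coverable p q K (W :\ e)].
  have ltWe : #|W :\ e| < n by move: ltWn; rewrite (cardsD1 e W) eW.
  have [M [MW *]] := IHn _ ltWe ncWe.
  by exists M; split=> //; apply: subset_trans MW (subD1set _ _).
have {}crit e : e \in W -> coverable p q K (W :\ e).
  by move=> eW; apply: contraR crit => h; apply/exists_inP; exists e.
exists W; split=> //.
- rewrite ltnNge; apply: contra ncW => leK; apply/coverableP; exists (p @: W), set0.
  rewrite cards0 addn0 (leq_trans (leq_imset_card _ _)) //; split=> //.
  by apply/coversP=> e eW; left; exact: imset_f.
- exact: critical_inj ncW crit.
- apply: (@critical_inj _ _ _ q p K); first by rewrite coverableC.
  by move=> e /crit; rewrite coverableC.
Qed.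

(** * Collapsing and homology *)

Section Fill.
Variables (K : fieldType) (V : finType).
Implicit Types (X Y F : {set {set V}}) (c w : chain K V) (s W : {set V}).
Local Open Scope ring_scope.

Definition down_closed X := forall s s' : {set V}, s \in X -> s' \subset s -> s' \in X.

(** The index [j] counts elements, so it is the dimension plus one. *)
Definition chain_on X j c := forall s, c s != 0 -> (s \in X) && (#|s| == j)%N.

Lemma boundary_coef c s' : boundary c s' = \sum_s c s * simplex_boundary K s s'.
Proof. by rewrite /boundary sum_ffunE; apply: eq_bigr => s _; rewrite ffunE. Qed.

Lemma simplex_boundary_coef s s' :
  simplex_boundary K s s' = \sum_(v in s) (-1) ^+ position v s * (s' == s :\ v)%:R.
Proof. by rewrite /simplex_boundary sum_ffunE; apply: eq_bigr => v _; rewrite !ffunE. Qed.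

Lemma simplex_boundary_neq0 s s' : simplex_boundary K s s' != 0 ->
  exists2 v, v \in s & s' = s :\ v.
Proof.
rewrite simplex_boundary_coef => n0.
have [/exists_inP[v vs /eqP ->]|no] := boolP [exists v in s, s' == s :\ v]; first by exists v.
move: n0; rewrite big1 ?eqxx // => v vs; case: eqP => [e|]; last by rewrite mulr0.
by case/exists_inP: no; exists v; rewrite ?e.
Qed.

Lemma boundary_neq0 c s' : boundary c s' != 0 ->
  exists s v, [/\ c s != 0, v \in s & s' = s :\ v].
Proof.
rewrite boundary_coef => n0.
have [/existsP[s /andP[cs]]|/existsPn no] :=
  boolP [exists s, (c s != 0) && (simplex_boundary K s s' != 0)].
  by case/simplex_boundary_neq0=> v vs ->; exists s, v.
move: n0; rewrite big1 ?eqxx // => s _; move: (no s); rewrite negb_and !negbK.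
by case/orP=> /eqP->; rewrite ?mul0r ?mulr0.
Qed.

Lemma simplex_boundary_facet W v : v \notin W ->
  simplex_boundary K (v |: W) W = (-1) ^+ position v (v |: W).
Proof.
move=> vW; rewrite simplex_boundary_coef (bigD1 v) ?setU11 //= setU1K // eqxx mulr1.
rewrite big1 ?addr0 // => u /andP[uvW uv]; case: eqP => [e|]; last by rewrite mulr0.
have : u \in W by move: uvW; rewrite !inE (negPf uv).
by rewrite e !inE eqxx.
Qed.

Lemma chain_on_boundary X j c : down_closed X -> chain_on X j.+1 c ->
  chain_on X j (boundary c).
Proof.
move=> Xd cX s' /boundary_neq0[s [v [/cX/andP[sX /eqP cs] vs ->]]].
rewrite (Xd _ _ sX) ?subD1set //=; move: cs; rewrite (cardsD1 v) vs add1n.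
by move/eq_add_S->.
Qed.

Lemma chain_on_sub X Y j c : X \subset Y -> chain_on X j c -> chain_on Y j c.
Proof. by move=> XY cX s /cX/andP[/(subsetP XY)-> ->]. Qed.

Lemma chain_on_sub_chain X j c w : chain_on X j c -> chain_on X j w ->
  chain_on X j (c - w).
Proof.
move=> cX wX s; rewrite !ffunE; have [->|/cX//] := eqVneq (c s) 0.
by rewrite sub0r oppr_eq0 => /wX.
Qed.

(* Relative homology of [(X, Y)] vanishes above the size of the critical cells:
   the relative cycle [c] is a relative boundary. *)
Lemma collapsible_fill m F : collapsible m F ->
  forall X Y, down_closed X -> down_closed Y -> Y \subset X -> X :\: Y = F ->
  forall j c, (m < j)%N -> chain_on X j c ->
    (forall s, boundary c s != 0 -> s \in Y) ->
  exists2 w, chain_on X j.+1 w & chain_on Y j (c - boundary w).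
Proof.
have fill0 X Y j c : (forall s, c s != 0 -> s \in Y) -> chain_on X j c ->
    exists2 w : chain K V, chain_on X j.+1 w & chain_on Y j (c - boundary w).
  move=> cY cX; exists 0; first by move=> s; rewrite ffunE eqxx.
  by move=> s; rewrite linear0 subr0 => cs; rewrite cY //; case/andP: (cX s cs).
elim=> [|W Wm|W v vW|F1 F2 _ IH1 _ IH2 F12] X Y Xd Yd YX XYF j c mj cX cY.
- apply: fill0 (cX) => s /cX/andP[sX _]; apply: contraT => sY.
  by have := in_set0 s; rewrite -XYF inE sX sY.
- apply: fill0 (cX) => s /cX/andP[sX /eqP sj]; apply: contraT => sY.
  have : s \in X :\: Y by rewrite inE sX sY.
  by rewrite XYF inE => /eqP sW; rewrite -sW sj leqNgt mj in Wm.
- have XY s : s \in X -> s != W -> s != v |: W -> s \in Y.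
    move=> sX sW svW; apply: contraT => sY.
    have : s \in X :\: Y by rewrite inE sX sY.
    by rewrite XYF !inE (negPf sW) (negPf svW).
  have [WX WY] : W \in X /\ W \notin Y.
    by have : W \in X :\: Y by [rewrite XYF !inE eqxx]; rewrite inE => /andP[].
  have [vWX vWY] : v |: W \in X /\ v |: W \notin Y.
    have : v |: W \in X :\: Y by rewrite XYF !inE eqxx orbT.
    by rewrite inE => /andP[].
  have cvW : #|v |: W| = #|W|.+1 by rewrite cardsU1 vW.
  (* In degree [#|W|] a multiple of the boundary of [v |: W] cancels the coefficient at [W]; the
     sign occurs twice and squares to 1. *)
  have [jW|jW] := eqVneq j #|W|.
    pose a : K := c W * (-1) ^+ position v (v |: W).
    pose w : chain K V := a *: simplex K (v |: W).
    have wX : chain_on X j.+1 w.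
      move=> s; rewrite !ffunE; case: (eqVneq s (v |: W)) => [->|_]; last by rewrite scaler0 eqxx.
      by rewrite vWX cvW jW eqxx.
    exists w => // s ns0.
    have : (s \in X) && (#|s| == j) by apply: (chain_on_sub_chain cX (chain_on_boundary Xd wX)).
    case/andP=> sX /eqP sj; rewrite sj eqxx andbT; apply: XY => //; last first.
      by apply: contraTneq (leqnn j) => svW; rewrite -{1}sj svW cvW jW ltnn.
    apply: contraNneq ns0 => ->; rewrite !ffunE /w linearZ /= boundary_simplex ffunE.
    rewrite simplex_boundary_facet // /a -[_ *: _]/(_ * _) -mulrA -expr2 -exprM mulnC exprM.
    by rewrite sqrrN !expr1n mulr1 subrr.
  apply: fill0 (cX) => s cs; have /andP[sX /eqP sj] := cX s cs.
  have sW : s != W by apply: contraNneq jW => <-; rewrite sj.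
  (* No simplex of the chain other than [v |: W] can have [W] as a facet, since it would lie in [Y]
     and force [W] into [Y]. A nonzero coefficient at [v |: W] would thus survive in the boundary at
     [W]. *)
  apply: (XY s) => //; apply: (contraNneq _ WY) => svW; apply: cY.
  rewrite boundary_coef (bigD1 (v |: W)) //= big1 ?addr0.
    by rewrite simplex_boundary_facet // mulf_neq0 -?svW // expf_neq0 // oppr_eq0 oner_eq0.
  move=> s1 ne1; have [->|cs1] := eqVneq (c s1) 0; first by rewrite mul0r.
  have [->|] := eqVneq (simplex_boundary K s1 W) 0; first by rewrite mulr0.
  case/simplex_boundary_neq0=> u us1 Wu; have /andP[s1X /eqP s1j] := cX s1 cs1.
  case/negP: WY; apply: (Yd s1); last by rewrite Wu subD1set.
  apply: (XY s1) => //; apply: contraTneq us1 => s1W.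
  by move/setP: Wu => /(_ u); rewrite s1W !inE eqxx /= => ->.
- have F2Y : X :\: (Y :|: F1) = F2.
    apply/setP=> s; have /setP/(_ s) := XYF; rewrite !inE negb_or.
    case s1: (s \in F1); last by rewrite andbT => ->.
    by rewrite andbF => _; apply/esym/negP=> s2; case/negP: (F12 s s s1 s2).
  have F1X : F1 \subset X.
    by apply/subsetP=> s s1; have /setP/(_ s) := XYF; rewrite !inE s1 => /andP[].
  have F1Y : (Y :|: F1) :\: Y = F1.
    apply/setP=> s; have /setP/(_ s) := XYF; rewrite !inE.
    by case: (s \in Y) => //= /esym/norP[/negPf ->].
  (* The intermediate complex [Y :|: F1] is legitimate because [F2] lies above [F1]; the chain is
     pushed first into it and then into [Y]. *)
  have Y1d : down_closed (Y :|: F1).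
    move=> s s' /setUP sY s's.
    have sX : s \in X by case: sY; [exact: (subsetP YX)|exact: (subsetP F1X)].
    have s'X := Xd _ _ sX s's; apply: contraT => s'Y.
    have s'2 : s' \in F2 by rewrite -F2Y inE s'Y.
    case: sY => [/Yd/(_ s's) s'Y1|s1]; first by rewrite inE s'Y1 in s'Y.
    by case/negP: (F12 s s' s1 s'2).
  have Y1X : Y :|: F1 \subset X by rewrite subUset YX.
  have [s /cY sY|w2 w2X w2Y] := IH2 X _ Xd Y1d Y1X F2Y j c mj cX.
    by rewrite inE sY.
  have [s|w1 w1Y w1c] := IH1 _ Y Y1d Yd (subsetUl _ _) F1Y j _ mj w2Y.
    by rewrite linearB /= boundary_boundary subr0; exact: cY.
  exists (w2 + w1).
    move=> s; rewrite ffunE; have [->|/w2X//] := eqVneq (w2 s) 0.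
    by rewrite add0r => /(chain_on_sub Y1X w1Y).
  by rewrite linearD opprD addrA.
Qed.

Lemma chainsP (X : scomplex V) d c :
  reflect (forall s, c s != 0 -> (s \in X) && (#|s|%:Z == d + 1)) (c \in chains K X d).
Proof.
apply: (iffP idP) => [/memv_sumP[f fX ->] s|cX].
  rewrite sum_ffunE; apply: contraNT => ns; apply/eqP; apply: big1 => s' s'X.
  have /vlineP[a ->] := fX s' s'X; rewrite !ffunE.
  by case: eqP => [ss'|_]; [rewrite ss' s'X in ns|rewrite scaler0].
have -> : c = \sum_s c s *: simplex K s.
  apply/ffunP=> s; rewrite sum_ffunE (bigD1 s) //= big1 ?addr0 => [|s' ns].
    by rewrite !ffunE eqxx [RHS]mulr1.
  by rewrite !ffunE eq_sym (negPf ns) scaler0.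
apply: memv_suml => s _; have [->|/cX sX] := eqVneq (c s) 0; first by rewrite scale0r mem0v.
by rewrite memvZ // /chains (bigD1 s) //= (subvP (addvSl _ _)) ?memv_line.
Qed.

Lemma homology_class_eq0 (X : scomplex V) d (z : subvs_of (cycles K X d)) :
  (homology_class z == 0) = (vsval z \in boundaries K X d).
Proof.
rewrite -[0 : reduced_homology K X d](linear0 (@classv K _ _)) classv_eq subr0.
by rewrite -memv_preim lfunE.
Qed.

(** If a cycle of [X] bounds [u] in [Y], then [u] is a relative cycle on sets of [d + 2] elements,
    more than [m]. Filling it replaces [u] by a chain of [X] with the same boundary. *)
Lemma homology_incl_inj (X Y : scomplex V) (XY : X \subset Y) (d : nat) m :
  (m <= d.+1)%N -> collapsible m (Y :\: X) -> injective (homology_incl K d%:Z XY).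
Proof.
move=> md cXY; apply: raddf_inj => h; rewrite -(classv_repr h).
move: (repr _) => z; rewrite -/(homology_class z).
move=> /(etrans (esym (homology_inclE XY z)))/eqP; rewrite homology_class_eq0 => /memv_imgP[u /chainsP uY].
rewrite lfunE /= => zu; apply/eqP; rewrite homology_class_eq0.
have uY' : chain_on Y d.+2 u.
  by move=> s /uY/andP[-> /eqP cs]; move: cs; clear; lia.
have [||w wY wX] := collapsible_fill cXY (@faces_closed _ Y) (@faces_closed _ X) XY erefl _ uY'.
- by [].
- move=> s; rewrite -zu; have := subvsP z; rewrite memv_cap => /andP[/chainsP zX _].
  by case/zX/andP.
apply/memv_imgP; exists (u - boundary w); last first.
  by rewrite lfunE /= linearB /= boundary_boundary subr0.
apply/chainsP=> s /wX/andP[-> /eqP ->]; clear; lia.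
Qed.

End Fill.

(** * Bipartite graphs *)

Section BipartiteGraph.
Variables (T : finType) (A : {set T}).
Implicit Types (e : {set T}) (G : sgraph T) (W : {set {set T}}).

Definition bipartition G := forall e, e \in edges G ->
  exists x y, [/\ x \in A, y \notin A & e = [set x; y]].

(** The option type makes the ends total functions on all vertex sets, so that edges fit the
    abstract setting with maps [p] and [q]. *)
Definition left_end e : option T := [pick x in e :&: A].
Definition right_end e : option T := [pick y in e :\: A].

Lemma edge_ends G e : bipartition G -> e \in edges G ->
  exists x y, [/\ x \in A, y \notin A, e = [set x; y], left_end e = Some x
    & right_end e = Some y].
Proof.
move=> bG /bG[x [y [xA yA ->]]]; exists x, y; split=> //.
  rewrite /left_end; case: pickP => [z|/(_ x)]; last by rewrite !inE eqxx xA.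
  by rewrite !inE => /andP[/orP[]/eqP-> //]; rewrite (negPf yA).
rewrite /right_end; case: pickP => [z|/(_ y)]; last by rewrite !inE eqxx orbT yA.
by rewrite !inE => /andP[zA /orP[]/eqP e_z]; rewrite ?e_z // in zA *; rewrite xA in zA.
Qed.

(** As [A] separates the sides, a vertex shared by two edges is the left end of both or the right
    end of both. *)
Lemma trivIset_ends G W : bipartition G -> W \subset edges G ->
  reflect ({in W &, injective left_end} /\ {in W &, injective right_end}) (trivIset W).
Proof.
move=> bG /subsetP WG; apply: (iffP trivIsetP) => [dW|[injl injr] e1 e2 e1W e2W].
  have common e1 e2 z : e1 \in W -> e2 \in W -> z \in e1 -> z \in e2 -> e1 = e2.
    move=> e1W e2W z1 z2; apply: contraTeq isT => /(dW _ _ e1W e2W)/pred0P/(_ z).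
    by rewrite /= z1 z2.
  split=> e1 e2 e1W e2W;
    have [x1 [y1 [_ _ E1 l1 r1]]] := edge_ends bG (WG e1 e1W);
    have [x2 [y2 [_ _ E2 l2 r2]]] := edge_ends bG (WG e2 e2W).
    by rewrite l1 l2 => -[x12]; apply: (common _ _ x1); rewrite // ?E1 ?E2 !inE ?x12 eqxx.
  by rewrite r1 r2 => -[y12]; apply: (common _ _ y1); rewrite // ?E1 ?E2 !inE ?y12 eqxx orbT.
apply: contraR => /pred0Pn[z /= /andP[]].
have [x1 [y1 [x1A y1A E1 l1 r1]]] := edge_ends bG (WG e1 e1W).
have [x2 [y2 [x2A y2A E2 l2 r2]]] := edge_ends bG (WG e2 e2W).
rewrite {1}E1 {1}E2 !inE => /orP[]/eqP-> /orP[]/eqP e12.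
- by apply/eqP/injl; rewrite // l1 l2 e12.
- by rewrite -e12 x1A in y2A.
- by rewrite e12 x2A in y1A.
- by apply/eqP/injr; rewrite // r1 r2 e12.
Qed.

Lemma matching_number_leq K G : bipartition G ->
  (matching_number G <= K) = coverable left_end right_end K (edges G).
Proof.
move=> bG; apply/bigmax_leqP/idP => [leK|cG M /andP[MG tM]].
  apply: contraT => /konig[M [MG ltK injl injr]].
  suff /leK : (M \subset edges G) && trivIset M by rewrite leqNgt ltK.
  by rewrite MG; apply/(trivIset_ends bG MG).
by have [] := trivIset_ends bG MG tM; exact: coverable_matching cG MG.
Qed.

Lemma mem_NM t G W : bipartition G ->
  (W \in NM t.+1 G) = (W \subset edges G) && coverable left_end right_end t W.
Proof.
move=> bG; rewrite inE; case WG: (W \subset edges G) => //=.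
rewrite ltnS matching_number_leq /= ?(setIidPr WG) // => e.
by rewrite inE => /andP[/bG].
Qed.

End BipartiteGraph.

Local Open Scope ring_scope.

Theorem theorem2p1 (K : fieldType) (t : nat) (T : finType) (G H : sgraph T)
    (e : {set T}) (t_ge2 : (2 <= t)%N) (bipG : bipartite G)
    (HG : spanning_subgraph H G) (eGH : e \in edges G :\: edges H) :
  injective
    (homology_incl K (2%:Z * t%:Z - 3%:Z) (NM_add_edge t e HG)).
Proof.
have [A bG] := bipG.
case: t t_ge2 => [//|k] k_ge1; have [eH eG] : e \notin edges H /\ e \in edges G.
  by move: eGH; rewrite inE => /andP[].
(* With [t = k + 1] the degree is [2k - 1], a natural number since [k >= 1], and the bound [2k] is
   exactly one more. *)
have -> : 2%:Z * k.+1%:Z - 3%:Z = (k.*2.-1)%:Z by clear -k_ge1; lia.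
apply: (@homology_incl_inj _ _ _ _ _ _ k.*2); first by clear -k_ge1; lia.
have bH : bipartition A H by move=> f /(subsetP HG); exact: bG.
have bHe : bipartition A (add_edge G H e) by move=> f /= /setIP[]/bG.
have eHe : e \in edges (add_edge G H e) by rewrite !inE eG eqxx.
(* The faces gained by passing from [H] to [H + e] are precisely those containing [e]: the covering
   condition does not depend on the graph. *)
have := collapsible_link (left_end A) (right_end A) k eHe; congr collapsible.
apply/setP=> W; rewrite [LHS]inE [RHS]inE (mem_NM _ _ bH) (mem_NM _ _ bHe).
case: coverable; rewrite ?andbF // !andbT; case eW: (e \in W) => /=.
  rewrite andbT; case: (boolP (W \subset edges H)) => //= /subsetP/(_ e eW).
  by rewrite (negPf eH).
rewrite andbF; apply/esym/negP=> /andP[/negP nH WHe]; apply: nH; apply/subsetP=> f fW.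
have := subsetP WHe f fW; rewrite !inE => /andP[_ /orP[/eqP fe|//]].
by rewrite -fe fW in eW.
Qed.
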